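(* Let $X$ be a complex Banach space, $\phi\in(0,\pi)$, and let $T:\overline{\Sigma_{\pi-\phi}}\to\mathcal{B}(X)$ be continuous on $\overline{\Sigma_{\pi-\phi}}$ and holomorphic on $\Sigma_{\pi-\phi}$. If $$\mathcal{R}(\{T(\lambda):\lambda\in\Sigma_{\pi-\phi}\})=:C<\infty,$$ then for all $\phi'\in(\phi,\pi)$ $$\mathcal{R}(\{\lambda T'(\lambda):\lambda\in\Sigma_{\pi-\phi'}\})\le\frac{C}{\sin(\phi'-\phi)^2}.$$ Consequently, for every $k\in\mathbb{N}$ and $\phi'\in(\phi,\pi)$, $\mathcal{R}(\{\lambda^kT^{(k)}(\lambda):\lambda\in\Sigma_{\pi-\phi'}\})<\infty$.
   Context: $\Sigma_\vartheta=\{z\in\mathbb{C}\setminus\{0\}:|\arg z|<\vartheta\}$ for $\vartheta\in(0,\pi]$. $\mathcal{B}(X)$ is the Banach space of bounded linear operators on $X$. A family $\mathcal{T}\subseteq\mathcal{B}(X,Y)$ is $\mathcal{R}$-bounded if for some (then all) $p\in[1,\infty)$ there is $C_p>0$ such that $\|\sum_{\nu=1}^N\varepsilon_\nu T_\nu x_\nu\|_{L_p(\Omega;Y)}\le C_p\|\sum_{\nu=1}^N\varepsilon_\nu x_\nu\|_{L_p(\Omega;X)}$ for all $N\in\mathbb{N}$, $T_\nu\in\mathcal{T}$, $x_\nu\in X$ and independent random variables $\varepsilon_\nu$ on a probability space $\Omega$ with $\mathbb{P}(\varepsilon_\nu=\pm1)=\frac12$. For a fixed $p$, $\mathcal{R}(\mathcal{T})=\mathcal{R}_p(\mathcal{T})$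 denotes the infimum of such constants $C_p$. *)

(* Defs.v *)
From HB Require Import structures.
From mathcomp Require Import all_boot all_order all_algebra.
From mathcomp Require Import complex.
From mathcomp Require Import all_classical all_reals all_analysis.

Set Implicit Arguments.
Unset Strict Implicit.
Unset Printing Implicit Defensive.

Import Order.TTheory GRing.Theory Num.Theory.
Import numFieldNormedType.Exports.

Local Open Scope classical_set_scope.
Local Open Scope complex_scope.
Local Open Scope ring_scope.

(* The norm of a normedModType over R[i] takes its values in R[i]; [rnorm] is
   the same norm seen as a real number (see [rnormE]). *)
Section rnorm.
Context {R : realType} {V : normedModType R[i]}.
Implicit Types x y : V.

Definition rnorm (x : V) : R := complex.Re `|x|.

Lemma rnormE x : (rnorm x)%:C = `|x|.
Proof.
have /ger0_Im Im0 : 0 <= `|x| := normr_ge0 x.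
by rewrite /rnorm; case: `|x| Im0 => a b /= ->.
Qed.

Lemma rnorm_ge0 x : 0 <= rnorm x.
Proof. by rewrite -ler0c rnormE. Qed.

Lemma rnorm_eq0 x : rnorm x = 0 -> x = 0.
Proof. by move=> x0; apply/normr0_eq0; rewrite -rnormE x0. Qed.

Lemma rnorm0 : rnorm (0 : V) = 0.
Proof. by rewrite /rnorm normr0. Qed.

Lemma ler_rnormD x y : rnorm (x + y) <= rnorm x + rnorm y.
Proof. by rewrite -lecR rmorphD /= !rnormE ler_normD. Qed.

Lemma rnormZ (a : R[i]) x : rnorm (a *: x) = complex.Re `|a| * rnorm x.
Proof.
by rewrite /rnorm normrZ -(rnormE x) [`|a|]normc_def /= mulr0 subr0.
Qed.

End rnorm.

Section bounded_operators.
Context {R : realType}.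

Section type.
Context (X Y : normedModType R[i]).

Definition bounded_linear : {pred X -> Y} := fun f =>
  `[< linear f /\ exists M : R, forall x, rnorm (f x) <= M * rnorm x >].

Record bop := Bop {
  bop_fun :> X -> Y;
  bop_subproof : bop_fun \in bounded_linear
}.

HB.instance Definition _ := [isSub for bop_fun].
HB.instance Definition _ := [Choice of bop by <:].

Fact bounded_linear_submod_closed : GRing.submod_closed bounded_linear.
Proof.
split=> [|a f g /asboolP[lf [M fM]] /asboolP[lg [N gN]]].
  apply/asboolP; split=> [a x y|]; first by rewrite /= scaler0 addr0.
  by exists 0 => x; rewrite mul0r rnorm0.
apply/asboolP; split=> [b x y|].
  suff : a *: f (b *: x + y) + g (b *: x + y) =
    b *: (a *: f x + g x) + (a *: f y + g y) by [].
  by rewrite lf lg !scalerDr !scalerA (mulrC a b) addrACA.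
exists (complex.Re `|a| * M + N) => x.
rewrite [leLHS]/(rnorm (a *: f x + g x)) (le_trans (ler_rnormD _ _))//.
rewrite mulrDl lerD// rnormZ -mulrA ler_wpM2l//.
exact: (@rnorm_ge0 R R[i]^o).
Qed.

HB.instance Definition _ :=
  GRing.isSubmodClosed.Build _ _ bounded_linear bounded_linear_submod_closed.
HB.instance Definition _ := [SubChoice_isSubLmodule of bop by <:].

Lemma bopP (A : bop) : linear A.
Proof. by have /asboolP[] := bop_subproof A. Qed.

Lemma bop_bounded (A : bop) : exists M : R, forall x, rnorm (A x) <= M * rnorm x.
Proof. by have /asboolP[] := bop_subproof A. Qed.

HB.instance Definition _ (A : bop) :=
  GRing.isLinear.Build R[i] X Y _ (bop_fun A) (bopP A).

Lemma bopDE (A B : bop) x : (A + B) x = A x + B x.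
Proof. by []. Qed.

Lemma bopZE a (A : bop) x : (a *: A) x = a *: A x.
Proof. by []. Qed.

Lemma bopE (A B : bop) : (forall x, A x = B x) -> A = B.
Proof. by move=> AB; apply: val_inj; apply/funext. Qed.

(* The usual operator norm; it makes bop X Y a normed module over R[i], which
   is complete when Y is. *)
Definition opnorm (A : bop) : R :=
  sup [set rnorm (A x) | x in [set x | rnorm x <= 1]].

Lemma opnorm_has_sup (A : bop) :
  has_sup [set rnorm (A x) | x in [set x | rnorm x <= 1]].
Proof.
split; first by exists (rnorm (A 0)), 0 => //=; rewrite rnorm0.
have [M AM] := bop_bounded A; exists `|M| => _ [x /= x1 <-].
rewrite (le_trans (AM x))// (@le_trans _ _ (`|M| * rnorm x))//.
  by rewrite ler_wpM2r ?rnorm_ge0// ler_norm.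
by rewrite ler_piMr.
Qed.

Lemma opnorm_ge0 (A : bop) : 0 <= opnorm A.
Proof.
rewrite (le_trans (rnorm_ge0 (A 0)))//.
apply: ub_le_sup; first by case: (opnorm_has_sup A).
by exists 0 => //=; rewrite rnorm0.
Qed.

Lemma opnorm_le (A : bop) M : (forall x, rnorm x <= 1 -> rnorm (A x) <= M) ->
  opnorm A <= M.
Proof.
move=> AM; apply: ge_sup; first by case: (opnorm_has_sup A).
by move=> _ [x /= x1 <-]; exact: AM.
Qed.

Lemma rnorm_bop (A : bop) x : rnorm (A x) <= opnorm A * rnorm x.
Proof.
have [->|x0] := eqVneq x 0; first by rewrite linear0 !rnorm0 mulr0.
have nx : 0 < rnorm x.
  rewrite lt_neqAle rnorm_ge0 andbT eq_sym.
  by apply: contra x0 => /eqP/rnorm_eq0 ->.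
have nV : complex.Re `|(rnorm x)^-1%:C : R[i]| = (rnorm x)^-1.
  by rewrite normc_def /= expr0n addr0 sqrtr_sqr ger0_norm// invr_ge0 ltW.
rewrite -ler_pdivrMr// mulrC -nV -rnormZ -linearZ.
apply: ub_le_sup; first by case: (opnorm_has_sup A).
by exists ((rnorm x)^-1%:C *: x) => //=; rewrite rnormZ nV mulVf ?gt_eqF.
Qed.

Fact ler_opnormD (A B : bop) :
  (opnorm (A + B))%:C <= (opnorm A)%:C + (opnorm B)%:C.
Proof.
rewrite -rmorphD /= lecR; apply: opnorm_le => x x1.
rewrite bopDE (le_trans (ler_rnormD _ _))// lerD//.
  by rewrite (le_trans (rnorm_bop A x))// ler_piMr// opnorm_ge0.
by rewrite (le_trans (rnorm_bop B x))// ler_piMr// opnorm_ge0.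
Qed.

Lemma opnormZ_le (a : R[i]) (A : bop) :
  opnorm (a *: A) <= complex.Re `|a| * opnorm A.
Proof.
have a0 : 0 <= complex.Re `|a| := @rnorm_ge0 R R[i]^o a.
apply: opnorm_le => x x1; rewrite bopZE rnormZ ler_wpM2l//.
by rewrite (le_trans (rnorm_bop A x))// ler_piMr// opnorm_ge0.
Qed.

Fact opnormZ (a : R[i]) (A : bop) :
  (opnorm (a *: A))%:C = `|a| * (opnorm A)%:C.
Proof.
have na : (complex.Re `|a|)%:C = `|a| := @rnormE R R[i]^o a.
rewrite -na -rmorphM; congr (_%:C).
apply/le_anti/andP; split; first exact: opnormZ_le.
have [->|a0] := eqVneq a 0; first by rewrite normr0 mul0r opnorm_ge0.
have na0 : 0 < complex.Re `|a| by rewrite -ltcR na normr_gt0.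
rewrite -ler_pdivlMl// -{1}(scale1r A) -(mulVf a0) -scalerA.
rewrite (le_trans (opnormZ_le _ _))// ler_wpM2r ?opnorm_ge0//.
by rewrite normfV -na -fmorphV.
Qed.

Fact opnorm_eq0 (A : bop) : (opnorm A)%:C = 0 -> A = 0.
Proof.
move=> /(congr1 (@complex.Re R))/= A0; apply: bopE => x.
apply: rnorm_eq0; apply/eqP; rewrite eq_le rnorm_ge0 andbT.
by rewrite (le_trans (rnorm_bop A x))// A0 mul0r.
Qed.

HB.instance Definition _ := Lmodule_isNormed.Build R[i] bop
  ler_opnormD opnormZ opnorm_eq0.

Lemma bop_normE (A : bop) : rnorm A = opnorm A.
Proof. by []. Qed.

End type.

Section complete.
Context (X : normedModType R[i]) (Y : completeNormedModType R[i]).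

Fact bop_complete (F : set_system (bop X Y)) :
  ProperFilter F -> cauchy F -> cvg F.
Proof.
move=> FF /cauchyP Fc.
have Fball (e : R) : 0 < e -> exists A0 : bop X Y,
    \forall A \near F, forall x, rnorm (bop_fun A x - A0 x) <= e * rnorm x.
  move=> e0; have [|A0 FA0] := Fc e%:C; first by rewrite ltcR.
  exists A0; near=> A => x.
  have : ball A0 e%:C A by near: A.
  rewrite -ball_normE /= distrC -rnormE ltcR bop_normE => /ltW AA0.
  by rewrite (le_trans (rnorm_bop (A - A0) x))// ler_wpM2r// rnorm_ge0.
have ReE (e : R[i]) : 0 < e -> e = (complex.Re e)%:C /\ 0 < complex.Re e.
  by case: e => a b; rewrite ltcE /= => /andP[/eqP -> ->].
have cvgx (x : X) : cvg ((fun A : bop X Y => A x) @ F).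
  apply: cauchy_cvg; apply/cauchyP => e /ReE[-> re0].
  have nx0 : 0 < rnorm x + 1 by rewrite ltr_wpDl// rnorm_ge0.
  have [|A0 FA0] := Fball (complex.Re e / (rnorm x + 1)).
    by rewrite divr_gt0.
  exists (A0 x); apply: filterS FA0 => A /(_ x)/le_lt_trans AA0.
  rewrite /= -ball_normE /= distrC -rnormE ltcR AA0//.
  by rewrite mulrAC ltr_pdivrMr// ltr_pM2l// ltrDl.
pose L x : Y := lim ((fun A : bop X Y => A x) @ F).
have FL (e : R) : 0 < e ->
    \forall A \near F, forall x, rnorm (bop_fun A x - L x) <= e * rnorm x.
  move=> e0; have [|A0 FA0] := Fball (e / 2); first by rewrite divr_gt0.
  have A0L x : rnorm (A0 x - L x) <= e / 2 * rnorm x.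
    apply/ler_addgt0Pr => d d0.
    have dC : 0 < d%:C :> R[i] by rewrite ltcR.
    have Ld : \forall A \near F, `|L x - bop_fun A x| <= d%:C.
      exact: (@cvgr_dist_le _ _ _ _ _ (fun A : bop X Y => A x) _ (cvgx x)).
    have [A [/(_ x) AA0 LA]] := filter_ex (filterI FA0 Ld).
    rewrite -(subrK (A x) (A0 x)) -addrA (le_trans (ler_rnormD _ _))//.
    rewrite lerD//; first by rewrite -lecR rnormE distrC -rnormE lecR.
    by rewrite -lecR rnormE distrC.
  near=> A => x; rewrite -(subrK (A0 x) (A x)) -addrA.
  rewrite (le_trans (ler_rnormD _ _))// [e]splitr mulrDl lerD//.
  by move: x; near: A.
have linL : linear L.
  move=> a x y; apply: cvg_lim => //.
  rewrite (_ : (fun A : bop X Y => A (a *: x + y)) =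
               (fun A : bop X Y => a *: A x + A y)); last first.
    by apply/funext => A; rewrite linearP.
  by apply: cvgD; [apply: cvgZr|]; exact: cvgx.
have bL : exists M, forall x, rnorm (L x) <= M * rnorm x.
  near F => A; exists (opnorm A + 1) => x.
  rewrite -(subrK (A x) (L x)) addrC (le_trans (ler_rnormD _ _))//.
  rewrite mulrDl lerD ?rnorm_bop// -lecR rnormE distrC -rnormE lecR.
  by move: x; near: A; exact: FL.
have LP : L \in @bounded_linear X Y by apply/asboolP.
apply/cvg_ex; exists (Bop LP); apply/cvgrPdist_le => e /ReE[-> e0].
near=> A; rewrite distrC -rnormE lecR bop_normE; apply: opnorm_le => x x1.
rewrite -[leRHS]mulr1 (@le_trans _ _ (complex.Re e * rnorm x))//.
  by move: x {x1}; near: A; exact: FL.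
by rewrite ler_wpM2l// ltW.
Unshelve. all: by end_near. Qed.

HB.instance Definition _ := Uniform_isComplete.Build (bop X Y) bop_complete.

End complete.
End bounded_operators.


Section sector.
Context {R : realType}.

(* The principal value of the argument, in ]-pi, pi] (see [cargP]); the value
   at 0 is irrelevant. *)
Definition carg (z : R[i]) : R :=
  let a := acos (complex.Re z / complex.Re `|z|) in
  if 0 <= complex.Im z then a else - a.

Lemma cargP (z : R[i]) : z != 0 ->
  -pi < carg z <= pi /\ z = `|z| * (cos (carg z) +i* sin (carg z)).
Proof.
have cV : (complex.Re `|z|)%:C = `|z| := @rnormE R R[i]^o z.
move=> z0; set r := complex.Re `|z| in cV *.
have r0 : 0 < r by rewrite -ltcR cV normr_gt0.
have r2 : r ^+ 2 = complex.Re z ^+ 2 + complex.Im z ^+ 2.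
  apply: complexI; rewrite rmorphXn /= cV.
  by rewrite add_Re2_Im2.
set c := complex.Re z / r.
have c2 : c ^+ 2 + (complex.Im z / r) ^+ 2 = 1.
  by rewrite !expr_div_n -mulrDl -r2 divff// sqrf_eq0 gt_eqF.
have c1 : -1 <= c <= 1.
  rewrite -ler_norml -(@ler_sqr _ `|c|) ?nnegrE// expr1n.
  by rewrite real_normK ?num_real// -c2 lerDl sqr_ge0.
have sE : sin (acos c) = `|complex.Im z| / r.
  rewrite sin_acos// -[1]c2 addrC addKr sqrtr_sqr normrM normfV.
  by rewrite (gtr0_norm r0).
rewrite -cV /carg -/r -/c; split.
  case: ifPn => [Im0|]; last rewrite -ltNge => Im0.
    by rewrite acos_lepi// andbT (@lt_le_trans _ _ 0) ?acos_ge0// oppr_lt0 pi_gt0.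
  rewrite ltrN2 (@le_trans _ _ 0) ?oppr_le0 ?acos_ge0 ?pi_ge0// andbT.
  apply: acos_ltpi; case/andP: c1 => c1 ->; rewrite andbT lt_neqAle c1 andbT.
  apply/eqP => cN1; move: c2; rewrite -cN1 sqrrN expr1n => /eqP.
  by rewrite -subr_eq0 addrAC subrr add0r sqrf_eq0 mulf_eq0 invr_eq0 lt_eqF// gt_eqF.
have zE : z = r%:C * ((complex.Re z / r) +i* (complex.Im z / r)).
  by case: (z) => a b; simpc; rewrite mulrC divfK ?gt_eqF// mulrC divfK ?gt_eqF.
rewrite {1}zE; congr (_ * _); case: ifPn => [Im0|]; last rewrite -ltNge => Im0.
  by rewrite acosK ?in_itv// sE ger0_norm.
by rewrite cosN sinN acosK ?in_itv// sE ltr0_norm// mulNr opprK.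
Qed.

Definition sector (theta : R) : set R[i]^o :=
  [set z | z != 0 /\ `|carg z| < theta].

End sector.

(* Complex differentiability at every point of A, meant for an open A. *)
Definition holomorphic_on {R : realType} {V : normedModType R[i]}
    (A : set R[i]^o) (f : R[i]^o -> V) :=
  forall z, A z -> derivable f z 1.

Section R_bound.
Context {R : realType}.

Definition mutually_independent {d} {Omega : measurableType d}
    {P : probability Omega R} {I : finType} (X : I -> {RV P >-> R}) :=
  forall (J : {set I}) (B : I -> set R), (forall i, measurable (B i)) ->
  (P (\bigcap_(i in [set` J]) (X i @^-1` B i)) =
   \prod_(i in J) P (X i @^-1` B i))%E.

Definition rademacher {d} {Omega : measurableType d} {P : probability Omega R}
    (X : {RV P >-> R}) :=
  P (X @^-1` [set 1]) = (2^-1)%:E /\ P (X @^-1` [set -1]) = (2^-1)%:E.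

Context {X Y : normedModType R[i]}.
Implicit Types (p C : R) (F : set (bop X Y)).

Definition R_bounded_by p C F :=
  forall d (Omega : measurableType d) (P : probability Omega R)
    (N : nat) (eps : 'I_N -> {RV P >-> R}),
    mutually_independent eps -> (forall nu, rademacher (eps nu)) ->
  forall (T : 'I_N -> bop X Y) (x : 'I_N -> X), (forall nu, F (T nu)) ->
  ('N[P]_p%:E[(fun w => (rnorm (\sum_nu (eps nu w)%:C *: T nu (x nu)))%:E)] <=
   C%:E * 'N[P]_p%:E[(fun w => (rnorm (\sum_nu (eps nu w)%:C *: x nu))%:E)])%E.

(* Equal to +oo when F is not R-bounded (ereal_inf set0 = +oo). *)
Definition R_bound p F : \bar R :=
  ereal_inf [set C%:E | C in [set C | 0 < C /\ R_bounded_by p C F]].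

End R_bound.

(* Main.v *)
Require Import Defs.
From HB Require Import structures.
From mathcomp Require Import all_boot all_order all_algebra.
From mathcomp Require Import complex.
From mathcomp Require Import all_classical all_reals all_analysis.
From mathcomp Require Import measurable_realfun ring lra.

Set Implicit Arguments.
Unset Strict Implicit.
Unset Printing Implicit Defensive.

Import Order.TTheory GRing.Theory Num.Theory.
Import numFieldNormedType.Exports.

Local Open Scope classical_set_scope.
Local Open Scope ring_scope.

(** The idea.  Fix [l] in the smaller sector and let [d = phi' - phi].  In the
    logarithmic coordinate, [G s = T (l * exp s)] is holomorphic on the strip
    [|Im s| < d] with values in the given R-bounded family, and
    [G' 0 = l *: T' l].  For [0 < r < d], Cauchy's formula on the circle of radius
    [r] and the vanishing of the mean of [G (r e^(it)) e^(it)] give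

      G' 0 = 1/(2 pi) * integral over [0, 2 pi] of (2 cos t / r) *: G (r e^(it)) dt.

    The kernel is real and its total mass is [4 / (pi r)], so [l *: T' l] belongs to
    [4 / (pi d)] times the closed absolutely convex hull, over the reals, of the
    range of [T].  Passing to that hull does not increase an R-bound, and
    [4 / (pi d) <= 1 / sin^2 d].  A complex kernel would not do: in general the
    complex absolutely convex hull has a larger R-bound.  The proof below has the
    constant 4/3 instead of [4 / pi], which still satisfies
    [4 / (3 d) <= 1 / sin^2 d] ([sin_sqr_le]).

    For the higher derivatives, [U_k z = z^k *: T^(k) z] satisfies
    [z U_k' = k *: U_k + U_(k+1)], and the same argument on successively smaller
    sectors gives the R-boundedness of [U_(k+1)] from that of [U_k] ([euler_step]).

    The complex analysis is done for functions with values in a normed space, with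
    midpoint sums in place of integrals.  Goursat's theorem ([goursat]) says that
    the sums around a parallelogram tend to 0; applied in a logarithmic variable
    around a circle it yields the formula above as a limit of sums
    ([derivative_abs_convex]).  The sums are finite, so membership in a closed
    absolutely convex set is immediate.  Differentiability of [T'] follows from
    Cauchy's estimate and completeness ([derivative_differentiable]).

    On the probabilistic side, the p-th moment of a Rademacher sum is a finite
    average over sign patterns ([Lnorm_rademacher]), which is convex and even in each
    vector separately.  Hence a bound for all choices of operators in a family
    extends, one index at a time, to its closed absolutely convex hull
    ([rademacher_sum_hull], [R_bounded_by_hull]). *)

(** * Dyadic subdivision of the unit square *)

Section dyadic_induction.
Context {R : realType}.
Implicit Types (s t : R) (k : nat).

Lemma nested_dyadic (u : nat -> R) :
    (forall k, u k.+1 = u k \/ u k.+1 = u k + 2^-1 ^+ k.+1) ->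
  exists x, forall k, u k <= x <= u k + 2^-1 ^+ k.
Proof.
move=> uS.
have h0 k : 0 < 2^-1 ^+ k :> R by rewrite exprn_gt0// invr_gt0.
have hS k : 2^-1 ^+ k = 2^-1 ^+ k.+1 + 2^-1 ^+ k.+1 :> R.
  by rewrite exprS; lra.
have u_nd j k : (j <= k)%N -> u j <= u k.
  elim: k => [|k IH]; first by rewrite leqn0 => /eqP ->.
  rewrite leq_eqVlt => /orP[/eqP->//|/IH/le_trans->//].
  by case: (uS k) => ->//; rewrite lerDl ltW.
have u_ni j k : (j <= k)%N -> u k + 2^-1 ^+ k <= u j + 2^-1 ^+ j.
  elim: k => [|k IH]; first by rewrite leqn0 => /eqP ->.
  rewrite leq_eqVlt => /orP[/eqP->//|/IH]; apply: le_trans.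
  by rewrite (hS k); case: (uS k) => ->; have := h0 k.+1; lra.
have ub j k : u j <= u k + 2^-1 ^+ k.
  have [jk|/ltnW kj] := leqP j k.
    by rewrite (le_trans (u_nd _ _ jk))// lerDl ltW.
  by rewrite (le_trans _ (u_ni _ _ kj))// lerDl ltW.
exists (sup (range u)) => k; apply/andP; split.
  apply: ub_le_sup; last by exists k.
  by exists (u 0%N + 2^-1 ^+ 0) => _ [j _ <-].
by apply: ge_sup; [exists (u 0%N), 0%N|move=> _ [j _ <-]].
Qed.

(** Subdivision in the style of Cousin's lemma: a property that passes from the
    four quarters of a square to the square, and that holds for all small
    squares around each point, holds for the unit square.  Otherwise bad squares
    nest down to a point.  It replaces compactness in Goursat's theorem and, with
    one coordinate idle, in the mean value inequality. *)
Lemma dyadic_induction (P : nat -> R -> R -> Prop) :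
    (forall k s t, let h := 2^-1 ^+ k.+1 in
      P k.+1 s t -> P k.+1 (s + h) t -> P k.+1 s (t + h) ->
      P k.+1 (s + h) (t + h) -> P k s t) ->
    (forall x y, 0 <= x <= 1 -> 0 <= y <= 1 ->
      exists k, forall s t, s <= x <= s + 2^-1 ^+ k -> t <= y <= t + 2^-1 ^+ k ->
        P k s t) ->
  P 0%N 0 0.
Proof.
move=> PS Ploc; apply: contrapT => nP0.
have /choice[f fP] (kp : nat * (R * R)) : exists q : R * R,
    let h := 2^-1 ^+ kp.1.+1 in
    [/\ ~ P kp.1 kp.2.1 kp.2.2 -> ~ P kp.1.+1 q.1 q.2,
        q.1 = kp.2.1 \/ q.1 = kp.2.1 + h & q.2 = kp.2.2 \/ q.2 = kp.2.2 + h].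
  case: kp => k [s t] /=; set h := 2^-1 ^+ k.+1.
  have [|nP] := pselect (P k s t); first by exists (s, t); split=> //=; left.
  apply: contrapT => nq; apply: nP.
  by apply: PS; apply: contrapT => nP; apply: nq;
     [exists (s, t)|exists (s + h, t)|exists (s, t + h)|exists (s + h, t + h)];
     split=> //=; by [left|right].
pose q := fix q k := if k is k'.+1 then f (k', q k') else (0, 0) : R * R.
have qP k : ~ P k (q k).1 (q k).2.
  by elim: k => [//|k IH]; have [+ _ _] := fP (k, q k); exact.
have [x xP] : exists x, forall k, (q k).1 <= x <= (q k).1 + 2^-1 ^+ k.
  by apply: nested_dyadic => k; have [_ + _] := fP (k, q k).
have [y yP] : exists y, forall k, (q k).2 <= y <= (q k).2 + 2^-1 ^+ k.
  by apply: nested_dyadic => k; have [_ _] := fP (k, q k).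
have [||k Pk] := Ploc x y.
- by have := xP 0%N; rewrite /= add0r expr0.
- by have := yP 0%N; rewrite /= add0r expr0.
- exact: (qP k (Pk _ _ (xP k) (yP k))).
Qed.

Lemma dyadic_small (L d : R) : 0 < d -> exists k, L * 2^-1 ^+ k < d.
Proof.
move=> d0; have : (fun k => L * 2^-1 ^+ k) @ \oo --> L * 0.
  by apply: cvgMr; apply: cvg_expr; rewrite ger0_norm//; lra.
rewrite mulr0 => /cvgrPdist_lt/(_ _ d0)[k _ /(_ k (leqnn k))] dk; exists k.
by apply: le_lt_trans dk; rewrite sub0r normrN ler_norm.
Qed.

End dyadic_induction.

(** * Contour sums and Goursat's theorem *)

Section midpoint_sums.
Context {K : numFieldType} {V : lmodType K}.
Implicit Types (f g : K -> V) (a l c : K).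

(** The midpoint rule for the integral of [f] along the segment [a, a + l] cut into
    2^n equal pieces.  The recursion on halves makes additivity under
    subdivision definitional, and the rule is exact on affine functions; with
    these two properties contour integrals can be replaced by these sums, in any
    module and without a passage to the limit. *)
Fixpoint midsum n f a l : V :=
  if n is m.+1 then midsum m f a (l / 2) + midsum m f (a + l / 2) (l / 2)
  else l *: f (a + l / 2).

Lemma midsumS n f a l :
  midsum n.+1 f a l = midsum n f a (l / 2) + midsum n f (a + l / 2) (l / 2).
Proof. by []. Qed.

Lemma eq_midsum n f g a l : f =1 g -> midsum n f a l = midsum n g a l.
Proof. by move=> /funext ->. Qed.

Lemma midsumD n f g a l :
  midsum n (fun s => f s + g s) a l = midsum n f a l + midsum n g a l.
Proof.
by elim: n a l => [|n IH] a l /=; [rewrite scalerDr|rewrite !IH addrACA].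
Qed.

Lemma midsumZ n c f a l : midsum n (fun s => c *: f s) a l = c *: midsum n f a l.
Proof.
elim: n a l => [|n IH] a l /=; last by rewrite !IH scalerDr.
by rewrite !scalerA mulrC.
Qed.

Lemma midsumN n f a l : midsum n (fun s => - f s) a l = - midsum n f a l.
Proof. by rewrite -scaleN1r -midsumZ; apply: eq_midsum => s; rewrite scaleN1r. Qed.

Lemma midsum_shift n f a l c : midsum n f (a + c) l = midsum n (fun s => f (s + c)) a l.
Proof.
elim: n a l => [|n IH] a l /=; first by rewrite addrAC.
by rewrite -!IH addrAC.
Qed.

Lemma midsum_affine n (A B : V) a l :
  midsum n (fun s => A + s *: B) a l = l *: (A + (a + l / 2) *: B).
Proof.
elim: n a l => [//|n IH] a l /=; rewrite !IH !scalerDr addrACA -scalerDl -splitr.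
by rewrite !scalerA -scalerDl; congr (_ + _ *: _); field.
Qed.

(** The sum around the boundary of the parallelogram spanned by [w] and [h] at [z]. *)
Definition rectsum n f z w h : V :=
  midsum n f z w + midsum n f (z + w) h - midsum n f (z + h) w - midsum n f z h.

Lemma rectsum_split n f z w h : rectsum n.+1 f z w h =
  rectsum n f z (w / 2) (h / 2) + rectsum n f (z + w / 2) (w / 2) (h / 2) +
  (rectsum n f (z + h / 2) (w / 2) (h / 2) +
   rectsum n f (z + w / 2 + h / 2) (w / 2) (h / 2)).
Proof.
have half (x y : K) : x + y = x + y / 2 + y / 2 by rewrite -addrA -splitr.
rewrite /rectsum /= (half z w) (half z h).
have -> : z + h / 2 + h / 2 + w / 2 = z + w / 2 + h / 2 + h / 2 by field.
have -> : z + h / 2 + w / 2 = z + w / 2 + h / 2 by field.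
have -> : z + w / 2 + w / 2 + h / 2 = z + w / 2 + h / 2 + w / 2 by field.
rewrite !opprD [RHS](@GRing.add V).[AC (4*4*(4*4)) ((1*5)*(6*14)*(11*15)*(4*12)*
  ((2*8)*(3*9)*(7*13)*(10*16)))] !subrr !addNr !addr0.
by [].
Qed.

Lemma rectsumD n f g z w h :
  rectsum n (fun s => f s + g s) z w h = rectsum n f z w h + rectsum n g z w h.
Proof.
rewrite /rectsum !midsumD !opprD.
by rewrite (@GRing.add V).[AC (2*2*2*2) ((1*3*5*7)*(2*4*6*8))].
Qed.

Lemma rectsum_affine n (A B : V) z w h :
  rectsum n (fun s => A + s *: B) z w h = 0.
Proof.
rewrite /rectsum !midsum_affine -addrA -opprD; apply/eqP; rewrite subr_eq0; apply/eqP.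
rewrite !scalerDr !scalerA [LHS]addrACA [RHS]addrACA -!scalerDl.
by congr (_ + _ *: _); field.
Qed.

End midpoint_sums.

Section complex_modules.
Local Open Scope complex_scope.
Context {R : realType} {V : normedModType R[i]}.
Local Notation C := R[i].
Local Notation cabs z := (@rnorm R R[i]^o z).
Implicit Types (x y : V) (a b z w h : C) (r s t : R).

Lemma cabsM a b : cabs (a * b) = cabs a * cabs b.
Proof. exact: (@rnormZ R R[i]^o). Qed.

Lemma rnormZl a x : rnorm (a *: x) = cabs a * rnorm x.
Proof. exact: rnormZ. Qed.

Lemma cabsR r : cabs r%:C = `|r|.
Proof. by rewrite /rnorm normc_def /= expr0n addr0 sqrtr_sqr. Qed.

Lemma rnormN x : rnorm (- x) = rnorm x.
Proof. by rewrite /rnorm normrN. Qed.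

Lemma rnormB x y : rnorm (x - y) = rnorm (y - x).
Proof. by rewrite -rnormN opprB. Qed.

Lemma ler_rnormB x y : rnorm (x - y) <= rnorm x + rnorm y.
Proof. by rewrite (le_trans (ler_rnormD _ _))// rnormN. Qed.

Lemma rnorm_gt0 x : (0 < rnorm x) = (x != 0).
Proof.
rewrite lt_neqAle rnorm_ge0 andbT eq_sym; congr (~~ _).
by apply/eqP/eqP => [/rnorm_eq0//|->]; exact: rnorm0.
Qed.

Lemma midsum_bound n (f : C -> V) a l (M : R) :
    (forall t, 0 <= t <= 1 -> rnorm (f (a + t%:C * l)) <= M) ->
  rnorm (midsum n f a l) <= cabs l * M.
Proof.
have C2 : 2^-1 = (2^-1 : R)%:C :> C by rewrite fmorphV rmorph_nat.
elim: n a l => [|n IH] a l fM /=.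
  rewrite rnormZl ler_wpM2l ?rnorm_ge0// mulrC C2 fM//; lra.
have -> : cabs l * M = cabs (l / 2) * M + cabs (l / 2) * M.
  by rewrite cabsM C2 cabsR ger0_norm//; lra.
apply: le_trans (ler_rnormD _ _) _; apply: lerD; apply: IH => t t01.
  have -> : t%:C * (l / 2) = (t / 2)%:C * l by rewrite rmorphM /= -C2; field.
  by apply: fM; lra.
have -> : a + l / 2 + t%:C * (l / 2) = a + ((1 + t) / 2)%:C * l.
  by rewrite rmorphM rmorphD /= -C2; field.
by apply: fM; lra.
Qed.

Lemma rectsum_bound n (f : C -> V) z w h (M : R) :
    (forall s t, 0 <= s <= 1 -> 0 <= t <= 1 ->
      rnorm (f (z + s%:C * w + t%:C * h)) <= M) ->
  rnorm (rectsum n f z w h) <= (cabs w + cabs h) * M *+ 2.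
Proof.
move=> fM.
have side a l : (forall t, 0 <= t <= 1 -> rnorm (f (a + t%:C * l)) <= M) ->
  rnorm (midsum n f a l) <= cabs l * M by exact: midsum_bound.
have h1 : rnorm (midsum n f z w) <= cabs w * M.
  by apply: side => t t01; have := fM t 0 t01; rewrite mul0r addr0; apply; lra.
have h2 : rnorm (midsum n f (z + w) h) <= cabs h * M.
  by apply: side => t t01; have := fM 1 t; rewrite mul1r; apply => //; lra.
have h3 : rnorm (midsum n f (z + h) w) <= cabs w * M.
  apply: side => t t01; rewrite addrAC.
  by have := fM t 1 t01; rewrite mul1r; apply; lra.
have h4 : rnorm (midsum n f z h) <= cabs h * M.
  by apply: side => t t01; have := fM 0 t; rewrite mul0r addr0; apply => //; lra.
rewrite /rectsum.
have := ler_rnormB (midsum n f z w + midsum n f (z + w) h - midsum n f (z + h) w)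
                   (midsum n f z h).
have := ler_rnormB (midsum n f z w + midsum n f (z + w) h) (midsum n f (z + h) w).
have := ler_rnormD (midsum n f z w) (midsum n f (z + w) h).
lra.
Qed.

(** With real-valued norms, so that estimates avoid the partial order of [R[i]]. *)
Definition has_derivative (f : C -> V) z (D : V) :=
  forall e, 0 < e -> exists2 d, 0 < d &
    forall h, cabs h < d -> rnorm (f (z + h) - (f z + h *: D)) <= e * cabs h.

(** Goursat's argument survives discretization.  On a small parallelogram [f] is
    affine up to an error that is small compared with the side, and the sums
    vanish on affine functions whatever the number of points: so the bound
    [e * 4^-k] on a parallelogram of level [k] is uniform in [n]. *)
Theorem goursat (f : C -> V) z w h :
    (forall s t, 0 <= s <= 1 -> 0 <= t <= 1 ->
      exists D, has_derivative f (z + s%:C * w + t%:C * h) D) ->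
  forall e, 0 < e ->
  exists n0, forall n, (n0 <= n)%N -> rnorm (rectsum n f z w h) <= e.
Proof.
move=> fD e e0.
pose P k s t := exists n0, forall n, (n0 <= n)%N ->
  rnorm (rectsum n f (z + s%:C * w + t%:C * h)
              ((2^-1 ^+ k)%:C * w) ((2^-1 ^+ k)%:C * h)) <= e * 4^-1 ^+ k.
suff : P 0%N 0 0 by rewrite /P !expr0 !mul0r !addr0 !mul1r mulr1.
have C2 : 2^-1 = (2^-1 : R)%:C :> C by rewrite fmorphV rmorph_nat.
apply: dyadic_induction => [k s t q [n1 r1] [n2 r2] [n3 r3] [n4 r4]|x y x01 y01].
  exists (maxn (maxn n1 n2) (maxn n3 n4)).+1 => -[//|n]; rewrite ltnS !geq_max.
  move=> /andP[/andP[/r1 {}r1 /r2 {}r2] /andP[/r3 {}r3 /r4 {}r4]].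
  rewrite rectsum_split.
  have qE u : (2^-1 ^+ k)%:C * u / 2 = q%:C * u :> C.
    by rewrite /q exprS rmorphM /= -C2; ring.
  rewrite !qE.
  rewrite (_ : z + _ + _ + q%:C * w + _ = z + (s + q)%:C * w + (t + q)%:C * h);
    last by rewrite !rmorphD /=; ring.
  rewrite (_ : z + _ + _ + q%:C * w = z + (s + q)%:C * w + t%:C * h);
    last by rewrite !rmorphD /=; ring.
  rewrite (_ : z + _ + _ + q%:C * h = z + s%:C * w + (t + q)%:C * h);
    last by rewrite !rmorphD /=; ring.
  have -> : e * 4^-1 ^+ k = (e * 4^-1 ^+ k.+1) *+ 2 + (e * 4^-1 ^+ k.+1) *+ 2.
    by rewrite exprS; lra.
  apply: le_trans (ler_rnormD _ _) _; rewrite !mulr2n.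
  by rewrite lerD// (le_trans (ler_rnormD _ _))// lerD.
have [D fxy] := fD _ _ x01 y01.
set zxy := z + _ + _ in fxy.
set L := cabs w + cabs h.
have L0 : 0 <= L by rewrite addr_ge0// rnorm_ge0.
have L2 : 0 < L ^+ 2 *+ 2 + 1 by have := sqr_ge0 L; lra.
have [|d d0 fd] := fxy (e / (L ^+ 2 *+ 2 + 1)); first by rewrite divr_gt0.
have [k kd] := dyadic_small L d0.
exists k => s t sx ty; exists 0%N => n _.
set q := 2^-1 ^+ k in sx ty kd *.
have q0 : 0 <= q by rewrite exprn_ge0// invr_ge0.
pose g u := f u - (f zxy - zxy *: D + u *: D).
(* Split f into its affine part at zxy and the remainder g. *)
rewrite [rectsum _ _ _ _ _](_ : _ =
    rectsum n (fun u => (f zxy - zxy *: D + u *: D) + g u)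
      (z + s%:C * w + t%:C * h) (q%:C * w) (q%:C * h)); last first.
  by congr rectsum; apply/funext => u; rewrite addrC subrK.
rewrite rectsumD rectsum_affine add0r.
have := @rectsum_bound n g (z + s%:C * w + t%:C * h) (q%:C * w) (q%:C * h)
  (e / (L ^+ 2 *+ 2 + 1) * (L * q)).
move=> /(_ _)/le_trans; apply => [s' t' s'01 t'01|].
  set u := _ + _; have : cabs (u - zxy) <= L * q.
    rewrite (_ : u - zxy = (s + s' * q - x)%:C * w + (t + t' * q - y)%:C * h).
      rewrite (le_trans (ler_rnormD _ _))// /L mulrDl !cabsM !cabsR.
      rewrite ![_ * q]mulrC; apply: lerD; rewrite ler_wpM2r ?rnorm_ge0// ler_norml.
        have : 0 <= s' * q <= q by nra.
        by lra.
      have : 0 <= t' * q <= q by nra.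
      by lra.
    by rewrite /u /zxy !rmorphB !rmorphD !rmorphM /=; ring.
  move=> uL; have /fd : cabs (u - zxy) < d by exact: le_lt_trans kd.
  rewrite (addrC zxy) subrK /g scalerBl (addrA (f zxy)) (addrAC (f zxy)).
  move=> /le_trans; apply.
  rewrite ler_wpM2l// divr_ge0//; lra.
rewrite !cabsM !cabsR (ger0_norm q0) -mulrDr -/L.
have -> : 4^-1 ^+ k = q ^+ 2 by rewrite /q -exprM mulnC exprM; congr (_ ^+ _); field.
rewrite (_ : _ *+ 2 = e * q ^+ 2 * ((L ^+ 2 *+ 2) / (L ^+ 2 *+ 2 + 1))).
  rewrite ler_piMr// ?mulr_ge0 ?sqr_ge0// ?ltW// ltr_pdivrMr// mul1r; lra.
by field; rewrite gt_eqF//; have := sqr_ge0 L; lra.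
Qed.

End complex_modules.

(** * Complex derivatives *)

Section derivative_estimate.
Context {K : numFieldType} {V : normedModType K}.

Lemma is_derive_dist (f : K^o -> V) (z : K^o) D : is_derive z 1 f D <->
  forall e, 0 < e -> exists2 d, 0 < d & forall h, `|h| < d ->
    `|f (z + h) - (f z + h *: D)| <= e * `|h|.
Proof.
have dq h : h != 0 ->
    `|f (z + h) - (f z + h *: D)| =
    `|D - h^-1 *: (f (h *: 1 + z) - f z)| * `|h|.
  move=> h0; rewrite mulrC -normrZ -normrN; congr `|_|.
  rewrite scalerBr scalerA divff// scale1r [h *: 1]mulr1 (addrC h) !opprB.
  by rewrite addrA (addrC (f z)).
split=> [fD e e0|fD].
  have : (fun h : K^o => h^-1 *: (f (h *: 1 + z) - f z)) @ 0^' --> D.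
    have [df <-] := fD; exact: df.
  move=> /cvgrPdist_le/(_ _ e0).
  move=> /nbhs_ballP[d /= d0 fd]; exists d => // h hd.
  have [->|h0] := eqVneq h 0.
    by rewrite addr0 scale0r addr0 subrr !normr0 mulr0.
  have := fd h; rewrite -ball_normE /= sub0r normrN => /(_ hd h0).
  by rewrite dq// => /ler_wpM2r; apply.
have fD' : (fun h : K^o => h^-1 *: (f (h *: 1 + z) - f z)) @ 0^' --> D.
  apply/cvgrPdist_le => e e0; have [d d0 fd] := fD e e0.
  apply/nbhs_ballP; exists d => //= h.
  rewrite -ball_normE /= sub0r normrN => /fd hd h0.
  by rewrite -(@ler_pM2r _ `|h|) ?normr_gt0// -dq.
by split; [apply/cvg_ex; exists D|exact/cvg_lim].
Qed.

End derivative_estimate.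

Section has_derivative_calculus.
Local Open Scope complex_scope.
Context {R : realType}.
Local Notation C := R[i].
Local Notation cabs z := (@rnorm R R[i]^o z).
Implicit Types (V : normedModType R[i]) (z w h : C) (e : R).

Lemma complex_gt0 (a : C) : 0 < a -> a = (complex.Re a)%:C /\ 0 < complex.Re a.
Proof. by case: a => x y; rewrite ltcE /= => /andP[/eqP -> ->]. Qed.

Lemma has_derivativeP V (f : C -> V) z D :
  has_derivative f z D <-> is_derive (z : R[i]^o) 1 (f : R[i]^o -> V) D.
Proof.
rewrite is_derive_dist; split=> fD e e0.
  have [ee e0'] := complex_gt0 e0; have [d d0 fd] := fD _ e0'.
  exists d%:C; first by rewrite ltcR.
  by move=> h; rewrite ee -!rnormE ltcR -rmorphM lecR => /fd.
have [|d d0 fd] := fD e%:C; first by rewrite ltcR.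
have [dd d0'] := complex_gt0 d0; exists (complex.Re d) => // h hd.
have := fd h; rewrite dd -!rnormE ltcR -rmorphM lecR; exact.
Qed.

Lemma derivable_has_derivative V (f : R[i]^o -> V) (z : R[i]^o) :
  derivable f z 1 -> has_derivative f z (derive1 f z).
Proof.
by move=> fz; apply/has_derivativeP; rewrite derive1E; exact/derivableP.
Qed.

Lemma has_derivative_derivable V (f : R[i]^o -> V) (z : R[i]^o) D :
  has_derivative f z D -> derivable f z 1 /\ derive1 f z = D.
Proof. by move=> /has_derivativeP[df <-]; rewrite derive1E. Qed.

(** Estimates may lose a constant factor [K], and [e] may be assumed small. *)
Lemma has_derivativeI V (f : C -> V) z D (K : R) : 0 <= K ->
    (forall e, 0 < e <= 1 -> exists2 d, 0 < d & forall h, cabs h < d ->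
      rnorm (f (z + h) - (f z + h *: D)) <= K * e * cabs h) ->
  has_derivative f z D.
Proof.
move=> K0 fD e e0; have K1 : 0 < K + 1 by lra.
have [|d d0 fd] := fD (Num.min 1 (e / (K + 1))).
  by rewrite lt_min ltr01 divr_gt0//= ge_min lexx.
exists d => // h /fd/le_trans; apply; rewrite ler_wpM2r ?rnorm_ge0//.
rewrite (@le_trans _ _ (K * (e / (K + 1))))//.
  by rewrite ler_wpM2l// ge_min lexx orbT.
by rewrite mulrCA -subr_ge0 (_ : _ - _ = e / (K + 1)) ?divr_ge0 ?ltW//; field; lra.
Qed.

Lemma has_derivative_near V (f : C -> V) z D : has_derivative f z D ->
  exists2 d, 0 < d & forall h, cabs h < d ->
    rnorm (f (z + h) - f z) <= (rnorm D + 1) * cabs h.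
Proof.
move=> /(_ 1 ltr01)[d d0 fd]; exists d => // h /fd hd.
rewrite (_ : f (z + h) - f z = f (z + h) - (f z + h *: D) + h *: D).
  by rewrite (le_trans (ler_rnormD _ _))// rnormZl; lra.
by rewrite opprD addrA subrK.
Qed.

Lemma has_derivative_cst V (v : V) z : has_derivative (fun=> v) z 0.
Proof.
move=> e e0; exists 1 => // h _.
by rewrite scaler0 addr0 subrr rnorm0 mulr_ge0 ?rnorm_ge0// ltW.
Qed.

Lemma has_derivative_id z : has_derivative (fun s => s : R[i]^o) z 1.
Proof.
move=> e e0; exists 1 => // h _.
by rewrite [h *: 1]mulr1 subrr rnorm0 mulr_ge0 ?rnorm_ge0// ltW.
Qed.

Lemma has_derivativeD V (f g : C -> V) z D E :
    has_derivative f z D -> has_derivative g z E ->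
  has_derivative (fun s => f s + g s) z (D + E).
Proof.
move=> fD gE; apply: (@has_derivativeI _ _ _ _ 2) => // e /andP[e0 _].
have [d d0 fd] := fD e e0; have [d' d'0 gd] := gE e e0.
exists (Num.min d d'); first by rewrite lt_min d0.
move=> h; rewrite lt_min => /andP[/fd {}fd /gd {}gd].
rewrite scalerDr addrACA opprD addrACA (le_trans (ler_rnormD _ _))//; lra.
Qed.

Lemma has_derivative_comp V (f : C -> R[i]^o) (g : C -> V) z D E :
    has_derivative f z D -> has_derivative g (f z) E ->
  has_derivative (g \o f) z (D *: E).
Proof.
move=> fD gE; have D0 := rnorm_ge0 D; have E0 := rnorm_ge0 E.
apply: (@has_derivativeI _ _ _ _ (rnorm D + 1 + rnorm E)); first by lra.
move=> e /andP[e0 e1].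
have [d d0 fd] := fD e e0; have [d' d'0 gd] := gE e e0.
have [c c0 fc] := has_derivative_near fD.
exists (Num.min (Num.min c d) (d' / (rnorm D + 1))).
  by rewrite !lt_min c0 d0 divr_gt0//; lra.
move=> h; rewrite !lt_min ltr_pdivlMr; last by lra.
move=> /andP[/andP[/fc {}fc /fd {}fd] hd'].
set k : R[i]^o := f (z + h) - f z in fc *.
have fE : f (z + h) = f z + k by rewrite [RHS]addrC subrK.
have /gd {}gd : rnorm k < d' by apply: le_lt_trans fc _; rewrite mulrC.
rewrite /= fE (_ : _ - _ = (g (f z + k) - (g (f z) + k *: E)) + (k - h *: D) *: E).
  rewrite (le_trans (ler_rnormD _ _))// rnormZl.
  have : cabs (k - h *: D) <= e * cabs h by rewrite /k -addrA -opprD.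
  by have := rnorm_ge0 (h : R[i]^o); nra.
have -> : (k - h *: D) *: E = k *: E - h *: (D *: E) by rewrite scalerBl scalerA.
by rewrite [RHS]addrA !opprD !addrA subrK.
Qed.

Lemma has_derivativeZ V (f : C -> R[i]^o) (g : C -> V) z D E :
    has_derivative f z D -> has_derivative g z E ->
  has_derivative (fun s => f s *: g s) z (D *: g z + f z *: E).
Proof.
move=> fD gE; have D0 := rnorm_ge0 D; have E0 := rnorm_ge0 E.
have g0 := rnorm_ge0 (g z); have f0 := rnorm_ge0 (f z).
apply: (@has_derivativeI _ _ _ _
  (rnorm (f z) + 1 + rnorm (g z) + rnorm E)); first by lra.
move=> e /andP[e0 e1].
have [d d0 fd] := fD e e0; have [d' d'0 gd] := gE e e0.
have [c c0 fc] := has_derivative_near fD.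
exists (Num.min (Num.min c (e / (rnorm D + 1))) (Num.min d d')).
  by rewrite !lt_min c0 d0 d'0 divr_gt0//; lra.
move=> h; rewrite !lt_min ltr_pdivlMr; last by lra.
move=> /andP[/andP[/fc {}fc he] /andP[/fd {}fd /gd {}gd]].
have h0 := rnorm_ge0 (h : R[i]^o).
have fe : cabs (f (z + h) - f z) <= e.
  by apply: le_trans fc _; rewrite mulrC ltW.
have fh : cabs (f (z + h)) <= rnorm (f z) + 1.
  by have := ler_rnormD (f (z + h) - f z) (f z); rewrite subrK; lra.
rewrite (_ : _ - _ = f (z + h) *: (g (z + h) - (g z + h *: E)) +
   (f (z + h) - (f z + h *: D)) *: g z + (h * (f (z + h) - f z)) *: E).
  rewrite (le_trans (ler_rnormD _ _))// (le_trans (lerD (ler_rnormD _ _) (lexx _)))//.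
  rewrite !rnormZl.
  set x := rnorm (_ - _) in gd *; set y := rnorm (_ - _) in fd *.
  have x0 : 0 <= x := rnorm_ge0 _.
  have H1 : cabs (f (z + h)) * x <= (rnorm (f z) + 1) * (e * cabs h).
    by apply: ler_pM => //; exact: rnorm_ge0.
  have H2 : y * rnorm (g z) <= e * cabs h * rnorm (g z) by rewrite ler_wpM2r.
  have H3 : cabs h * cabs (f (z + h) - f z) * rnorm E <= cabs h * e * rnorm E.
    by rewrite ler_wpM2r// ler_wpM2l.
  lra.
rewrite mulrBr !(scalerBl, scalerBr, scalerDl, scalerDr) !scalerA.
rewrite (mulrC (f (z + h)) h) !opprD [RHS](@GRing.add V).[AC (1*2*(1*2)*2)
  (1*5*(6*8)*((4*2)*(7*3)))] !subrr !addr0 [LHS]addrA.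
by [].
Qed.


(** The increment of [f] is compared with that of its derivative on dyadic pieces of
    the segment: the bound [M + e] per unit length holds near each point by
    differentiability there and is additive. *)
Lemma mean_value_inequality V (f df : C -> V) z w M :
    (forall t, 0 <= t <= 1 -> has_derivative f (z + t%:C * w) (df (z + t%:C * w))) ->
    (forall t, 0 <= t <= 1 -> rnorm (df (z + t%:C * w)) <= M) ->
  rnorm (f (z + w) - f z) <= M * cabs w.
Proof.
move=> fD dfM; apply/ler_addgt0Pr => e e0.
have w0 := rnorm_ge0 (w : R[i]^o).
pose P k s (_ : R) := rnorm (f (z + (s + 2^-1 ^+ k)%:C * w) - f (z + s%:C * w)) <=
  (M * cabs w + e) * 2^-1 ^+ k.
suff : P 0%N 0 0 by rewrite /P expr0 add0r mul0r addr0 mul1r mulr1.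
apply: (@dyadic_induction _ P) => [k s ? h P1 P2 _ _|x ? x01 _].
  rewrite /P.
  rewrite -(subrK (f (z + (s + h)%:C * w)) (f (z + (s + _)%:C * w))) -addrA.
  have hk : 2^-1 ^+ k = h + h by rewrite /h exprS; lra.
  rewrite (le_trans (ler_rnormD _ _))// hk addrA mulrDr lerD//.
have [|d d0 fd] := fD x x01 (e / (2 * (cabs w + 1))).
  by rewrite divr_gt0//; lra.
have [k kd] := dyadic_small (cabs w) d0; exists k => s ? sx _.
set q := 2^-1 ^+ k in sx kd *.
have q0 : 0 <= q by rewrite exprn_ge0// invr_ge0.
set y := z + x%:C * w in fd *; set D := df y in fd *.
have near t : `|t| <= q ->
    rnorm (f (z + (x + t)%:C * w) - (f y + (t%:C * w) *: D)) <= e / 2 * q.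
  move=> tq; rewrite rmorphD mulrDl addrA -/y.
  have tw : cabs (t%:C * w) <= q * cabs w.
    by rewrite cabsM cabsR ler_wpM2r.
  have /fd/le_trans : cabs (t%:C * w) < d.
    by apply: le_lt_trans tw _; rewrite mulrC.
  apply; rewrite (@le_trans _ _ (e / (2 * (cabs w + 1)) * (q * cabs w)))//.
    by apply: ler_wpM2l => //; apply: divr_ge0; lra.
  rewrite (_ : _ * _ = e / 2 * q * (cabs w / (cabs w + 1))); last by field; lra.
  by rewrite ler_piMr// ?mulr_ge0// ?divr_ge0 ?ltW// ltr_pdivrMr; lra.
have h1 : rnorm (f (z + (s + q)%:C * w) - (f y + ((s + q - x)%:C * w) *: D)) <= e / 2 * q.
  by have := near (s + q - x); rewrite (addrC x) subrK; apply; rewrite ler_norml; lra.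
have h2 : rnorm (f (z + s%:C * w) - (f y + ((s - x)%:C * w) *: D)) <= e / 2 * q.
  by have := near (s - x); rewrite (addrC x) subrK; apply; rewrite ler_norml; lra.
have h3 : rnorm ((q%:C * w) *: D) <= q * cabs w * M.
  rewrite rnormZl cabsM cabsR ger0_norm// ler_wpM2l ?mulr_ge0//; exact: dfM.
rewrite /P -/q.
set A := f (z + (s + q)%:C * w) in h1 *; set B := f (z + s%:C * w) in h2 *.
rewrite (_ : A - B = (A - (f y + ((s + q - x)%:C * w) *: D)) -
  (B - (f y + ((s - x)%:C * w) *: D)) + (q%:C * w) *: D).
  rewrite (le_trans (ler_rnormD _ _))// (le_trans (lerD (ler_rnormB _ _) (lexx _)))//.
  lra.
rewrite (_ : s + q - x = (s - x) + q); last by ring.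
rewrite (rmorphD _ (s - x)) mulrDl scalerDl.
rewrite opprB !opprD [RHS](@GRing.add V).[AC (1*(1*2)*3*1)
  ((1*7)*(5*2)*(6*3)*(8*4))] !subrr !addr0.
by [].
Qed.

End has_derivative_calculus.

(** * The complex exponential *)

Section complex_exponential.
Local Open Scope complex_scope.
Context {R : realType}.
Local Notation C := R[i].
Local Notation cabs z := (@rnorm R R[i]^o z).
Implicit Types (z w h : C) (t : R).

Lemma cabsE z : cabs z = Num.sqrt (complex.Re z ^+ 2 + complex.Im z ^+ 2).
Proof. by rewrite /rnorm normc_def. Qed.

Lemma ler_Re_cabs z : `|complex.Re z| <= cabs z.
Proof. by rewrite cabsE -sqrtr_sqr ler_wsqrtr// lerDl sqr_ge0. Qed.

Lemma ler_Im_cabs z : `|complex.Im z| <= cabs z.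
Proof. by rewrite cabsE -sqrtr_sqr ler_wsqrtr// lerDr sqr_ge0. Qed.

Lemma cabs_le z : cabs z <= `|complex.Re z| + `|complex.Im z|.
Proof.
rewrite cabsE -(@ler_sqr R) ?nnegrE ?sqrtr_ge0 ?addr_ge0//.
rewrite sqr_sqrtr ?addr_ge0 ?sqr_ge0// sqrrD !real_normK ?num_real//.
by have := normr_ge0 (complex.Re z); have := normr_ge0 (complex.Im z); nra.
Qed.

Definition cexp z : C :=
  (expR (complex.Re z))%:C * (cos (complex.Im z) +i* sin (complex.Im z)).

Lemma cexpD z w : cexp (z + w) = cexp z * cexp w.
Proof.
case: z w => a b [c d]; rewrite /cexp /= expRD cosD sinD rmorphM /=.
by simpc; congr (_ +i* _); ring.
Qed.

Lemma cexp0 : cexp 0 = 1.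
Proof. by rewrite /cexp /= expR0 cos0 sin0 mul1r. Qed.

Lemma cexpNK z : cexp (- z) * cexp z = 1.
Proof. by rewrite -cexpD addNr cexp0. Qed.

Lemma cabs_cexp z : cabs (cexp z) = expR (complex.Re z).
Proof.
rewrite cabsM cabsR (cabsE (_ +i* _)) /= cos2Dsin2 sqrtr1 mulr1.
by rewrite ger0_norm// expR_ge0.
Qed.

Lemma has_derivative_cexp0 : has_derivative (cexp : C -> R[i]^o) 0 1.
Proof.
have der (g : R -> R) (D : R) : is_derive (0 : R^o) 1 (g : R^o -> R^o) D ->
    forall e : R, 0 < e -> exists2 d : R, 0 < d & forall k : R, `|k| < d ->
      `|g k - (g 0 + k * D)| <= e * `|k|.
  move=> /is_derive_dist gD e e0; have [d d0 gd] := gD e e0; exists d => // k.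
  by move=> /gd; rewrite add0r.
apply: (@has_derivativeI _ _ _ _ _ 7) => // e /andP[e0 e1].
have [|a a0 expa] := der (@expR R) 1 _ e e0.
  by have := is_derive_expR (0 : R); rewrite expR0.
have [|b b0 cosb] := der (@cos R) 0 _ e e0.
  by have := is_derive_cos (0 : R); rewrite sin0 oppr0.
have [|c c0 sinc] := der (@sin R) 1 _ e e0.
  by have := is_derive_sin (0 : R); rewrite cos0.
exists (Num.min (Num.min a (e / 2)) (Num.min b c)).
  by rewrite !lt_min a0 b0 c0 divr_gt0.
move=> h; rewrite !lt_min => /andP[/andP[ha he] /andP[hb hc]].
have hx := ler_Re_cabs h; have hy := ler_Im_cabs h.
move: hx hy ha he hb hc; set x := complex.Re h; set y := complex.Im h.
set H := cabs h => hx hy ha he hb hc.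
have := expa x (le_lt_trans hx ha); have := cosb y (le_lt_trans hy hb).
have := sinc y (le_lt_trans hy hc).
rewrite expR0 cos0 sin0 mulr0 addr0 add0r !mulr1 => sy cy ex.
rewrite add0r cexp0 [h *: 1]mulr1.
apply: le_trans (cabs_le _) _; rewrite !raddfB !raddfD /=.
rewrite -/x -/y !mul0r subr0 addr0 oppr0 add0r -opprD.
have H0 : 0 <= H := rnorm_ge0 _.
have ex1 : `|expR x - 1| <= e.
  have := ler_normD (expR x - (1 + x)) x; rewrite opprD addrA subrK.
  have : e * `|x| <= `|x| by rewrite ler_piMl.
  by move: ex; rewrite opprD addrA; lra.
have ex3 : `|expR x| <= 2.
  by have := ler_normD (expR x - 1) 1; rewrite subrK normr1; lra.
have -> : expR x * cos y - (1 + x) = (expR x - (1 + x)) + expR x * (cos y - 1).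
  by ring.
have -> : expR x * sin y - y = expR x * (sin y - y) + (expR x - 1) * y.
  by ring.
apply: le_trans (lerD (ler_normD _ _) (ler_normD _ _)) _.
rewrite !normrM.
have e1' : e * `|x| <= e * H by rewrite ler_wpM2l// ltW.
have e2' : e * `|y| <= e * H by rewrite ler_wpM2l// ltW.
have k1 : `|expR x| * `|cos y - 1| <= 2 * (e * H).
  by apply: ler_pM => //; apply: le_trans cy _.
have k2 : `|expR x| * `|sin y - y| <= 2 * (e * H).
  by apply: ler_pM => //; apply: le_trans sy _.
have k3 : `|expR x - 1| * `|y| <= e * H by apply: ler_pM.
by have : 0 <= e * H by [rewrite mulr_ge0// ltW]; lra.
Qed.

Lemma has_derivative_cexp z : has_derivative (cexp : C -> R[i]^o) z (cexp z).
Proof.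
apply: (@has_derivativeI _ _ _ _ _ (cabs (cexp z))); first exact: rnorm_ge0.
move=> e /andP[e0 _]; have [d d0 cd] := has_derivative_cexp0 e0.
exists d => // h /cd; rewrite add0r cexp0 => hd.
rewrite cexpD (_ : _ - _ = cexp z * (cexp h - (1 + h *: (1 : R[i]^o)))).
  by rewrite cabsM -mulrA ler_wpM2l// rnorm_ge0.
by rewrite [h *: cexp z]mulrC [h *: 1]mulr1; ring.
Qed.

Lemma cexp_half_turn z : cexp (z + 'i * pi%:C) = - cexp z.
Proof.
rewrite cexpD -mulrN1; congr (_ * _).
by rewrite /cexp /= !mul0r !mul1r subr0 add0r expR0 cospi sinpi; simpc.
Qed.

End complex_exponential.

(** * Absolutely convex sets and weighted midpoint sums *)

Section abs_convex.
Local Open Scope complex_scope.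
Context {R : realType} {V : normedModType R[i]}.
Local Notation C := R[i].
Local Notation cabs z := (@rnorm R R[i]^o z).
Implicit Types (x y : V) (a b : R) (D : set V).

(** Absolute convexity over the reals: complex scalars of modulus 1 are not allowed,
    since they would cost a constant in the R-bounds. *)
Definition abs_convex D :=
  forall x y a b, D x -> D y -> `|a| + `|b| <= 1 -> D (a%:C *: x + b%:C *: y).

(** Topological closedness, in the form in which it is used. *)
Definition limit_closed D :=
  forall y, (forall e : R, 0 < e -> exists2 x, D x & rnorm (y - x) <= e) -> D y.

Lemma abs_convexZ D x a : abs_convex D -> D x -> `|a| <= 1 -> D (a%:C *: x).
Proof.
move=> Dc Dx a1; have := Dc x x a 0 Dx Dx; rewrite scale0r addr0; apply.
by rewrite normr0 addr0.
Qed.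

Lemma abs_convexD D x y a b : abs_convex D -> D x -> D y -> 0 <= a -> 0 <= b ->
  exists2 v, D v & a%:C *: x + b%:C *: y = (a + b)%:C *: v.
Proof.
move=> Dc Dx Dy a0 b0; have [ab0|ab0] := eqVneq (a + b) 0.
  have -> : a = 0 by lra.
  have -> : b = 0 by lra.
  by exists x => //; rewrite addr0 !scale0r addr0.
have ab : 0 < a + b by rewrite lt_neqAle eq_sym ab0 addr_ge0.
exists ((a / (a + b))%:C *: x + (b / (a + b))%:C *: y).
  apply: Dc => //; rewrite !ger0_norm ?divr_ge0 ?addr_ge0//.
  by rewrite -mulrDl divff.
by rewrite scalerDr !scalerA -!rmorphM /= !mulrA ![(a + b) * _]mulrC !mulfK.
Qed.

(** A sum of values [B t] in [D] with real weights [w t] lies in [c *: D], where [c] is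
    the total mass of the weights or, as here, of any majorant [P] of their
    absolute values. *)
Lemma midsum_abs_convex n D (B : R -> V) (w P : R -> R) (F : C -> V) c l p q :
    abs_convex D -> (forall t, D (B t)) -> (forall t, `|w t| <= P t) ->
    (forall t, F (c + t%:C * l) = (w t)%:C *: B t) -> 0 <= q ->
  0 <= midsum n (P : R -> R^o) p q /\
  exists2 x, D x & midsum n F (c + p%:C * l) (q%:C * l) =
    (l * (midsum n (P : R -> R^o) p q)%:C) *: x.
Proof.
move=> Dc DB wP FE.
have P0 t : 0 <= P t by rewrite (le_trans (normr_ge0 _) (wP t)).
have half t : t%:C * l / 2 = (t / 2)%:C * l :> C.
  by rewrite rmorphM fmorphV rmorph_nat; ring.
have move_start s t : c + s%:C * l + t%:C * l = c + (s + t)%:C * l.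
  by rewrite rmorphD mulrDl addrA.
elim: n p q => [|n IH] p q q0 /=.
  split; first by rewrite mulr_ge0.
  set t := p + q / 2.
  have [Pt|Pt] := eqVneq (P t) 0.
    exists (B t) => //; rewrite half move_start -/t FE.
    have -> : w t = 0 by apply/normr0_eq0/le_anti; rewrite normr_ge0 -Pt wP.
    by rewrite Pt scaler0 mulr0 !scale0r scaler0.
  exists ((w t / P t)%:C *: B t).
    by apply: abs_convexZ => //; rewrite normrM normfV (ger0_norm (P0 _))
      ler_pdivrMr ?mul1r// lt_neqAle eq_sym Pt P0.
  rewrite half move_start FE !scalerA; congr (_ *: _).
  rewrite (mulrC _ l) -!mulrA -!rmorphM /=; congr (_ * _%:C).
  by rewrite [q *: P t]/(q * P t) -mulrA (mulrC (P t)) divfK.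
have q20 : 0 <= q / 2 by lra.
rewrite half move_start.
have [a0 [x Dx ->]] := IH p _ q20.
have [b0 [y Dy ->]] := IH (p + q / 2) _ q20.
split; first by rewrite addr_ge0.
have [v Dv vE] := abs_convexD Dc Dx Dy a0 b0.
by exists v => //; rewrite -!scalerA -scalerDr vE.
Qed.

Lemma abs_convex_ball a : abs_convex [set x | rnorm x <= a].
Proof.
move=> x y b c /= xa ya bc; rewrite (le_trans (ler_rnormD _ _))// !rnormZl !cabsR.
by have := rnorm_ge0 x; have := normr_ge0 b; have := normr_ge0 c; nra.
Qed.

Lemma limit_closed_ball a : limit_closed [set x | rnorm x <= a].
Proof.
move=> y Dy; apply/ler_addgt0Pr => e /Dy[x /= xa yx].
by have := ler_rnormD (y - x) x; rewrite subrK; lra.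
Qed.

End abs_convex.

Section antiperiodic.
Context {K : numFieldType} {V : lmodType K}.

(** The exponentials that occur in the Cauchy formula have discrete mean zero. *)
Lemma midsum_antiperiodic n (g : K -> V) a l :
  (forall s, g (s + l / 2) = - g s) -> midsum n.+1 g a l = 0.
Proof.
move=> gN /=; rewrite midsum_shift (eq_midsum _ _ _ gN) midsumN.
by rewrite subrr.
Qed.

End antiperiodic.

Section cosine_majorant.
Context {R : realType}.

(** [|x| <= 1/4 + x^2 - 4/9 (x^2 - 1/4)^2] on [-1, 1] at [x = cos u], written as a
    cosine polynomial: its mean 2/3 slightly exceeds the mean 2/pi of [|cos|], but
    unlike the latter it is computed exactly by midpoint sums.  The polynomial
    touches [|x|] at 1/2 (twice) and at 1, which makes the mean minimal for its
    degree. *)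
Definition cos_majorant (u : R) := 2 / 3 + 7 / 18 * cos (2 * u) - cos (4 * u) / 18.

Lemma cos_majorantP (u : R) : `|cos u| <= cos_majorant u.
Proof.
have E : cos_majorant u = cos u ^+ 2 + 1 / 4 - 4 / 9 * (cos u ^+ 2 - 1 / 4) ^+ 2.
  rewrite /cos_majorant (_ : 4 * u = (u *+ 2) *+ 2); last by ring.
  by rewrite (mulr_natl u) !cos_mulr2n; field.
rewrite E -(real_normK (num_real (cos u))).
have := cos_max u; have := normr_ge0 (cos u); set x := `|cos u| => x0 x1.
have -> : x ^+ 2 + 1 / 4 - 4 / 9 * (x ^+ 2 - 1 / 4) ^+ 2 =
  x + (x - 1 / 2) ^+ 2 * (1 - 4 / 9 * (x + 1 / 2) ^+ 2) by field.
rewrite lerDl mulr_ge0 ?sqr_ge0//; nra.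
Qed.

Lemma midsum_cos_majorant n (c : R) :
  midsum n.+3 (fun t => c * cos_majorant (2 * pi * t) : R^o) 0 1 = c * (2 / 3).
Proof.
pose g t : R^o := c * (7 / 18) * cos (4 * pi * t).
pose h t : R^o := - (c / 18) * cos (8 * pi * t).
transitivity (midsum n.+3 (fun t => (c * (2 / 3) + t *: (0 : R^o)) + (g t + h t)) 0 1).
  apply: eq_midsum => t; rewrite scaler0 addr0 /cos_majorant /g /h.
  rewrite (_ : 2 * (2 * pi * t) = 4 * pi * t); last by ring.
  by rewrite (_ : 4 * (2 * pi * t) = 8 * pi * t); [field|ring].
rewrite midsumD midsum_affine midsumD scaler0 addr0 scale1r.
have g0 a : midsum n.+2 g a (1 / 2) = 0.
  apply: midsum_antiperiodic => s; rewrite /g.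
  by rewrite (_ : 4 * _ * _ = 4 * pi * s + pi) ?cosDpi ?mulrN//; field.
have h0 a : midsum n.+1 h a (1 / 2 / 2) = 0.
  apply: midsum_antiperiodic => s; rewrite /h.
  by rewrite (_ : 8 * _ * _ = 8 * pi * s + pi) ?cosDpi ?mulrN//; field.
by rewrite (midsumS n.+2 g) (midsumS n.+2 h) !(midsumS n.+1 h) !g0 !h0 !addr0.
Qed.

End cosine_majorant.

(** * The Cauchy formula with a real kernel *)

Section cauchy.
Local Open Scope complex_scope.
Context {R : realType} {V : normedModType R[i]}.
Local Notation C := R[i].
Local Notation cabs z := (@rnorm R R[i]^o z).
Implicit Types (z w h s : C) (e r t rho : R).

Let turn : C := 'i * (2 * pi)%:C.

Let cabs_turn : cabs turn = 2 * pi.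
Proof. by rewrite cabsE /= !mul0r !mul1r subr0 add0r expr0n add0r sqrtr_sqr
  ger0_norm// mulr_ge0// pi_ge0. Qed.

Let Re_line (a : R) t : complex.Re (a%:C + t%:C * turn) = a.
Proof. by rewrite /turn /=; ring. Qed.

Let turn2 : turn / 2 = 'i * pi%:C.
Proof. by rewrite /turn rmorphM /= rmorph_nat; field. Qed.

Let cexp_half s : cexp (s + turn / 2) = - cexp s.
Proof. by rewrite turn2 cexp_half_turn. Qed.

Let cexp_turn s : cexp (s + turn) = cexp s.
Proof. by rewrite [turn]splitr addrA !cexp_half opprK. Qed.

Let cexpN_half s : cexp (- (s + turn / 2)) = - cexp (- s).
Proof.
by rewrite opprD -[LHS]opprK -[X in - X = _]cexp_half subrK.
Qed.

Let cexpN_turn s : cexp (- (s + turn)) = cexp (- s).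
Proof. by rewrite opprD -[LHS]cexp_turn subrK. Qed.

Let cabs_cexpN s : cabs (cexp (- s)) = (cabs (cexp s))^-1.
Proof. by rewrite !cabs_cexp raddfN expRN. Qed.

Lemma has_derivativeN z : has_derivative (fun s => - s : R[i]^o) z (- 1).
Proof.
have := has_derivativeZ (has_derivative_cst (-1 : R[i]^o) z) (has_derivative_id z).
rewrite scale0r add0r [_ *: _]mulr1.
by rewrite (_ : (fun s : C => _) = (fun s => - s : R[i]^o))//; apply/funext => s;
  rewrite [LHS]mulN1r.
Qed.

(** In the variable [s] with [u = cexp s] the sums run over the circle [|u| = rho]
    with the kernel [1/u + u/rho^2].  There the kernel is the real function
    [2 cos(t) / rho]; the second term, whose contribution vanishes by Cauchy's
    theorem, serves only to make it real. *)
Let weight rho s : R[i]^o := cexp (- s) + (rho ^- 2)%:C * cexp s.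

Let H (f : C -> V) rho s := weight rho s *: f (cexp s).

Let has_derivative_H f rho s : (exists E, has_derivative f (cexp s) E) ->
  exists E, has_derivative (H f rho) s E.
Proof.
move=> [E fE].
have h1 := has_derivative_comp (has_derivative_cexp s) fE.
have h2 := has_derivative_comp (has_derivativeN s) (has_derivative_cexp (- s)).
have h3 := has_derivativeZ (has_derivative_cst ((rho ^- 2)%:C : R[i]^o) s)
  (has_derivative_cexp s).
by eexists; exact: has_derivativeZ (has_derivativeD h2 h3) h1.
Qed.

(** On a small circle [f u] may be replaced by [f 0 + u *: E]; of the resulting terms
    only the constant [E] has a nonzero mean. *)
Let small_circle f rho E e : 0 < rho -> 0 < e -> has_derivative f 0 E ->
  exists2 r, 0 < r <= rho & forall n,
    rnorm (midsum n.+2 (H f rho) (ln r)%:C turn - turn *: E) <= e.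
Proof.
move=> rho0 e0 fE; have pi0 := pi_gt0 R.
have [|d d0 fd] := fE (e / (8 * pi)); first by rewrite divr_gt0// mulr_gt0.
pose r := Num.min rho (d / 2).
have r0 : 0 < r by rewrite lt_min rho0 divr_gt0.
have rrho : r <= rho by rewrite ge_min lexx.
have rd : r < d by rewrite gt_min; apply/orP; right; lra.
exists r; first by rewrite r0.
move=> n; pose k : C := (rho ^- 2)%:C.
pose G1 s : V := weight rho s *: f 0.
pose G2 s : V := (k * (cexp s * cexp s)) *: E.
pose G3 s : V := weight rho s *: (f (cexp s) - (f 0 + cexp s *: E)).
have HE s : H f rho s = G1 s + ((E + s *: (0 : V)) + G2 s) + G3 s.
  rewrite /H /G1 /G2 /G3 scaler0 addr0 scalerBr scalerDr scalerA.
  have -> : weight rho s * cexp s = 1 + k * (cexp s * cexp s).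
    by rewrite [LHS]mulrDl cexpNK -(mulrA k).
  rewrite [(1 + _) *: E]scalerDl scale1r.
  by rewrite [RHS]addrC subrK.
rewrite (eq_midsum _ _ _ HE) 3!midsumD midsum_affine scaler0 addr0.
rewrite [midsum _ G1 _ _]midsum_antiperiodic => [|s]; last first.
  by rewrite /G1 /weight cexp_half cexpN_half mulrN -opprD scaleNr.
have -> : midsum n.+2 G2 (ln r)%:C turn = 0.
  rewrite midsumS; have G2N a : midsum n.+1 G2 a (turn / 2) = 0.
    apply: midsum_antiperiodic => s; rewrite /G2 -scaleNr; congr (_ *: _).
    rewrite -mulrN; congr (_ * _).
    by rewrite -!cexpD -cexp_half; congr cexp; field.
  by rewrite !G2N addr0.
rewrite add0r addr0 addrC addKr.
have -> : e = cabs turn * (e / (2 * pi)) by rewrite cabs_turn; field; lra.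
apply: midsum_bound => t _; rewrite rnormZl.
set s := _ + _.
have sr : cabs (cexp s) = r.
  by rewrite cabs_cexp /s Re_line lnK.
have := fd (cexp s); rewrite sr add0r => /(_ rd) fs.
have wr : cabs (weight rho s) <= 2 / r.
  rewrite (le_trans (ler_rnormD _ _))// cabsM cabs_cexpN sr cabsR ger0_norm; last first.
    by rewrite invr_ge0 exprn_ge0// ltW.
  have : rho ^- 2 * r <= r^-1; last by lra.
  by rewrite -ler_pdivlMr// -invfM lef_pV2 ?posrE ?mulr_gt0 ?exprn_gt0//
    expr2 ler_pM// ltW.
rewrite (@le_trans _ _ (2 / r * (e / (8 * pi) * r)))//.
  by apply: ler_pM => //; exact: rnorm_ge0.
rewrite (_ : 2 / r * _ = e / (4 * pi)); last by field; lra.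
rewrite ler_pM2l// lef_pV2 ?posrE ?mulr_gt0//; lra.
Qed.

(** Goursat's theorem on the rectangle [ln q, ln rho] x [0, 2 pi] in the logarithmic
    variable: the horizontal sides cancel by periodicity, so the means over the
    circles of radii [q] and [rho] agree in the limit. *)
Let circle_mean f rho r E e : 0 < rho < r -> 0 < e ->
    (forall s, cabs s < r -> exists E', has_derivative f s E') ->
    has_derivative f 0 E ->
  exists n0, forall n, (n0 <= n)%N ->
    rnorm (midsum n (H f rho) (ln rho)%:C turn - turn *: E) <= e.
Proof.
move=> /andP[rho0 rhor] e0 fd fE.
have [|q /andP[q0 qrho] Hq] := small_circle (e := e / 2) rho0 _ fE; first by lra.
pose z : C := (ln q)%:C; pose w : C := (ln rho - ln q)%:C.
have lnq : ln q <= ln rho by rewrite ler_ln.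
have [||n0 Hn] := @goursat _ _ (H f rho) z w turn _ (e / 2).
- move=> s t s01 t01; apply: has_derivative_H; apply: fd.
  apply: le_lt_trans rhor; rewrite cabs_cexp -rmorphM -rmorphD Re_line.
  rewrite -[leRHS]lnK// ler_expR; nra.
- lra.
exists n0.+2 => -[|[|n]] // nn0.
have := Hn n.+2 (leq_trans (leqnSn _) (leq_trans (leqnSn _) nn0)).
have := Hq n.
have -> : (ln rho)%:C = z + w by rewrite /z /w -rmorphD addrC subrK.
have per : midsum n.+2 (H f rho) (z + turn) w = midsum n.+2 (H f rho) z w.
  rewrite midsum_shift; apply: eq_midsum => s.
  by rewrite /H /weight cexp_turn cexpN_turn.
rewrite /rectsum per -/z; set A := midsum _ _ z w; set B := midsum _ _ (z + w) _.
set D := midsum _ _ z turn => DE AB.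
have -> : B - turn *: E = (D - turn *: E) + (A + B - A - D).
  by rewrite (addrAC A B) subrr add0r [RHS]addrC addrA subrK.
by rewrite (le_trans (ler_rnormD _ _))//; lra.
Qed.

Let weight_real rho t : 0 < rho ->
  weight rho ((ln rho)%:C + t%:C * turn) = (2 / rho * cos (2 * pi * t))%:C.
Proof.
move=> rho0.
have E b : cexp (b%:C + t%:C * turn) =
    (expR b)%:C * (cos (2 * pi * t) +i* sin (2 * pi * t)).
  rewrite /cexp Re_line /=; congr (_ * (cos _ +i* sin _)); ring.
have EN b : cexp (- (b%:C + t%:C * turn)) =
    (expR (- b))%:C * (cos (2 * pi * t) +i* - sin (2 * pi * t)).
  have -> x : cexp (- x) =
      (expR (- complex.Re x))%:C * (cos (complex.Im x) +i* - sin (complex.Im x)).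
    by case: x => x y; rewrite /cexp /= cosN sinN.
  rewrite Re_line /=.
  by congr (_ * (cos _ +i* - sin _)); ring.
rewrite /weight EN E expRN lnK//.
by simpc; congr (_ +i* _); field; lra.
Qed.

(** The derivative at the centre of a disc is the limit of the means of [f] with the
    kernel [2 cos(t) / rho], whose total mass is at most [4 / (3 rho)] by the
    majorant of [|cos|].  It is because this kernel is real that absolute
    convexity of [D] over the reals suffices. *)
Theorem derivative_abs_convex (f : C -> V) (D : set V) r E :
    abs_convex D -> limit_closed D -> 0 < r ->
    (forall s, cabs s < r -> exists E', has_derivative f s E') ->
    (forall s, cabs s < r -> D (f s)) ->
    has_derivative f 0 E ->
  D ((3 / 4 * r)%:C *: E).
Proof.
move=> Dc Dl r0 fd fD fE; have E0 := rnorm_ge0 E.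
have pi2 := pi_ge2 R.
apply: (Dl) => e e0.
(* A radius close to r: rho * E must be close to r * E. *)
pose rho := r - Num.min (r / 2) (e / (2 * (rnorm E + 1))).
have rho1 : r / 2 <= rho.
  have : Num.min (r / 2) (e / (2 * (rnorm E + 1))) <= r / 2 by rewrite ge_min lexx.
  by rewrite /rho; lra.
have rho2 : (r - rho) * rnorm E <= e / 2.
  rewrite /rho opprB addrC subrK.
  rewrite (@le_trans _ _ (e / (2 * (rnorm E + 1)) * rnorm E))//.
    by rewrite ler_wpM2r// ge_min lexx orbT.
  rewrite (_ : _ * _ = e / 2 * (rnorm E / (rnorm E + 1))); last by field; lra.
  by rewrite ler_piMr// ?ler_pdivrMr; lra.
have rho3 : rho < r.
  by rewrite /rho gtrBl lt_min !divr_gt0//; lra.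
have rho0 : 0 < rho by lra.
clearbody rho.
have [||n0 Hn] := @circle_mean f rho r E (e / (2 * r)) _ _ fd fE.
- by rewrite rho0.
- by rewrite divr_gt0//; lra.
have := Hn n0.+3 (leq_trans (leqnSn _) (leq_trans (leqnSn _) (leqnSn _))).
have [|||//|_ [x Dx]] := @midsum_abs_convex R V n0.+3 D
    (fun t => f (cexp ((ln rho)%:C + t%:C * turn)))
    (fun t => 2 / rho * cos (2 * pi * t))
    (fun t => 2 / rho * cos_majorant (2 * pi * t))
    (H f rho) (ln rho)%:C turn 0 1 Dc.
- move=> t; apply: fD; rewrite cabs_cexp Re_line lnK//.
- move=> t; have rho20 : 0 <= 2 / rho by rewrite divr_ge0// ltW.
  by rewrite normrM (ger0_norm rho20) ler_wpM2l// cos_majorantP.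
- by move=> t; rewrite /H weight_real.
rewrite midsum_cos_majorant mul0r addr0 mul1r => ->.
rewrite -scalerA -scalerBr rnormZl cabs_turn.
set y := _ *: x; move=> yE.
have {}yE : rnorm (y - E) <= e / (2 * r).
  by apply: le_trans yE; rewrite ler_peMl ?rnorm_ge0//; lra.
exists x => //.
have -> : x = (3 / 4 * rho)%:C *: y.
  rewrite /y scalerA -rmorphM (_ : _ * _ = 1) ?scale1r//; field; lra.
have -> : (3 / 4 * r)%:C *: E - (3 / 4 * rho)%:C *: y =
    (3 / 4 * (r - rho))%:C *: E - (3 / 4 * rho)%:C *: (y - E).
  by rewrite (scalerBr _ y) opprB [RHS]addrA -scalerDl -rmorphD -mulrDr subrK.
rewrite (le_trans (ler_rnormB _ _))// !rnormZl !cabsR !ger0_norm; [|lra|lra].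
have : 3 / 4 * rho * rnorm (y - E) <= 3 / 4 * rho * (e / (2 * r)).
  by rewrite ler_wpM2l//; lra.
have : rho * (e / (2 * r)) <= e / 2.
  rewrite (_ : _ * _ = e / 2 * (rho / r)); last by field; lra.
  by rewrite ler_piMr// ?ler_pdivrMr; lra.
lra.
Qed.

End cauchy.

(** * Derivatives of holomorphic functions are holomorphic *)

Section derivative_of_derivative.
Local Open Scope complex_scope.
Context {R : realType}.
Local Notation C := R[i].
Local Notation cabs z := (@rnorm R R[i]^o z).
Implicit Types (z w h s : C).

Lemma has_derivative_shift (V : normedModType R[i]) (f : C -> V) z s E :
  has_derivative f (z + s) E -> has_derivative (fun u => f (z + u)) s E.
Proof.
move=> fE e e0; have [d d0 fd] := fE e e0; exists d => // h /fd.
by rewrite addrA.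
Qed.

Lemma has_derivativeZr (V : normedModType R[i]) (f : C -> V) z (c : C) E :
  has_derivative f z E -> has_derivative (fun u => c *: f u) z (c *: E).
Proof.
move=> /(has_derivativeZ (has_derivative_cst (c : R[i]^o) z)).
by rewrite scale0r add0r.
Qed.

Lemma has_derivativeB (V : normedModType R[i]) (f g : C -> V) z D E :
    has_derivative f z D -> has_derivative g z E ->
  has_derivative (fun u => f u - g u) z (D - E).
Proof.
move=> fD /(has_derivativeZr (-1)) gE; rewrite -scaleN1r.
rewrite (_ : (fun u => _) = (fun u => f u + -1 *: g u)).
  exact: has_derivativeD.
by apply/funext => u; rewrite scaleN1r.
Qed.

(** The factor 4/3 bounds the mass of the real kernel; the complex kernel has mass 1. *)
Lemma cauchy_estimate (V : normedModType R[i]) (f : C -> V) z E (r M : R) :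
    0 < r ->
    (forall s, cabs (s - z) < r -> exists E', has_derivative f s E') ->
    (forall s, cabs (s - z) < r -> rnorm (f s) <= M) ->
    has_derivative f z E ->
  rnorm E <= 4 / (3 * r) * M.
Proof.
move=> r0 fd fM fE.
have /= := @derivative_abs_convex R V (fun s => f (z + s)) [set x | rnorm x <= M] r E
  (abs_convex_ball (a := M)) (limit_closed_ball (a := M)) r0.
rewrite rnormZl cabsR ger0_norm => [EM|]; last by lra.
have {EM} : 3 / 4 * r * rnorm E <= M.
  apply: EM => [s sr|s sr|].
  - have [|E' sE] := fd (z + s); first by rewrite (addrC z) addrK.
    by exists E'; exact: has_derivative_shift.
  - by apply: fM; rewrite (addrC z) addrK.
  - by apply: has_derivative_shift; rewrite addr0.
have r3 : 0 < 4 / (3 * r) by rewrite divr_gt0//; lra.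
rewrite -(ler_pM2l r3); apply: le_trans.
by rewrite le_eqVlt; apply/orP; left; apply/eqP; field; lra.
Qed.

(** Cauchy's estimate applied to [f],
    then to its increments [f (s + h) - f s], shows that [df] is locally Lipschitz;
    hence the difference quotients of [f] converge to [df] uniformly near [z], and
    Cauchy's estimate applied to the difference of two such quotients shows that
    the difference quotients of [df] at [z] satisfy the Cauchy criterion. *)
Theorem derivative_differentiable (V : completeNormedModType R[i])
    (f df : C -> V) z (r : R) : 0 < r ->
    (forall s, cabs (s - z) < r -> has_derivative f s (df s)) ->
  exists E, has_derivative df z E.
Proof.
move=> r0 fd.
have [d d0 fnear] : exists2 d, 0 < d & forall h, cabs h < d ->
    rnorm (f (z + h) - f z) <= (rnorm (df z) + 1) * cabs h.
  by apply: has_derivative_near; apply: fd; rewrite subrr rnorm0.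
(* The estimates are made on discs of radii 4q, 3q, 2q and q around z. *)
pose q := Num.min r d / 4.
have m0 : 0 < Num.min r d by rewrite lt_min r0.
have q0 : 0 < q by rewrite /q; lra.
have qr : 4 * q <= r by rewrite /q mulrC divfK// ge_min lexx.
have qd : 4 * q <= d by rewrite /q mulrC divfK// ge_min lexx orbT.
clearbody q.
have tri a b : cabs (a + b - z) <= cabs (a - z) + cabs b.
  by rewrite addrAC ler_rnormD.
have trid a b c : cabs (a - c) <= cabs (a - b) + cabs (b - c).
  by rewrite (le_trans _ (ler_rnormD _ _))// addrA subrK.
have fd' s : cabs (s - z) < 4 * q -> has_derivative f s (df s).
  by move=> sq; apply: fd; apply: lt_le_trans sq qr.
pose M := rnorm (f z) + (rnorm (df z) + 1) * (4 * q).
have fM s : cabs (s - z) < 4 * q -> rnorm (f s) <= M.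
  move=> sq; have := fnear (s - z) (lt_le_trans sq qd).
  rewrite (addrC z) subrK => fs; have := ler_rnormD (f s - f z) (f z); rewrite subrK.
  have : (rnorm (df z) + 1) * cabs (s - z) <= (rnorm (df z) + 1) * (4 * q).
    by apply: ler_wpM2l; [rewrite addr_ge0// rnorm_ge0|exact: ltW].
  by rewrite /M; lra.
pose L := 4 / (3 * q) * M.
have dfL s : cabs (s - z) < 3 * q -> rnorm (df s) <= L.
  move=> sq; apply: (@cauchy_estimate _ f s) => //.
  - by move=> u us; exists (df u); apply: fd'; have := trid u s z; lra.
  - by move=> u us; apply: fM; have := trid u s z; lra.
  - by apply: fd'; lra.
have fL s h : cabs (s - z) < 2 * q -> cabs h < q -> rnorm (f (s + h) - f s) <= L * cabs h.
  move=> sq hq; apply: (@mean_value_inequality _ _ f df) => t t01.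
    apply: fd'; have := tri s (t%:C * h); rewrite cabsM cabsR ger0_norm; last by lra.
    have : t * cabs h <= cabs h by rewrite ler_piMl ?rnorm_ge0//; lra.
    by lra.
  apply: dfL; have := tri s (t%:C * h); rewrite cabsM cabsR ger0_norm; last by lra.
  have : t * cabs h <= cabs h by rewrite ler_piMl ?rnorm_ge0//; lra.
  by lra.
pose L2 := 4 / (3 * q) * L.
have c0 : 0 <= 4 / (3 * q) by rewrite divr_ge0//; lra.
have L20 : 0 <= L2.
  apply: mulr_ge0 => //; apply: mulr_ge0 => //; have := rnorm_ge0 (f z).
  have := rnorm_ge0 (df z); rewrite /M; nra.
have dfL2 s h : cabs (s - z) < q -> cabs h < q -> rnorm (df (s + h) - df s) <= L2 * cabs h.
  move=> sq hq; rewrite /L2 -mulrA.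
  have der u : cabs (u - z) < 2 * q ->
      has_derivative (fun u => f (u + h) - f u) u (df (u + h) - df u).
    move=> uq; apply: has_derivativeB; last by apply: fd'; lra.
    rewrite (_ : (fun _ => _) = (fun u => f (h + u))); last first.
      by apply/funext => v; rewrite addrC.
    apply: has_derivative_shift; rewrite addrC; apply: fd'.
    by have := tri u h; lra.
  apply: (@cauchy_estimate _ (fun u => f (u + h) - f u) s) => //.
  - by move=> u us; eexists; apply: der; have := trid u s z; lra.
  - by move=> u us; apply: fL => //; have := trid u s z; lra.
  - by apply: der; lra.
have quad s h : cabs (s - z) < q -> cabs h < q ->
    rnorm (f (s + h) - (f s + h *: df s)) <= L2 * cabs h * cabs h.
  move=> sq hq; have th t : 0 <= t <= 1 -> cabs (t%:C * h) <= cabs h.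
    move=> t01; rewrite cabsM cabsR ger0_norm; last by lra.
    by rewrite ler_piMl ?rnorm_ge0//; lra.
  have := @mean_value_inequality _ _ (fun u => f u - u *: df s)
    (fun u => df u - (1 : R[i]^o) *: df s) s h (L2 * cabs h).
  rewrite (_ : _ - _ - _ = f (s + h) - (f s + h *: df s)); last first.
    rewrite scalerDl opprB !opprD.
    by rewrite [LHS](@GRing.add V).[AC (1*2*2) (1*(5*3)*(4*2))] subrr addr0.
  apply=> t t01.
    apply: has_derivativeB.
      by apply: fd'; have := tri s (t%:C * h); have := th t t01; lra.
    have := has_derivativeZ (has_derivative_id (s + t%:C * h))
      (has_derivative_cst (df s) (s + t%:C * h)).
    by rewrite scaler0 addr0.
  have := th t t01; rewrite scale1r => tq.
  have tq' : cabs (t%:C * h) < q by exact: le_lt_trans tq hq.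
  apply: le_trans (dfL2 _ _ sq tq') _.
  by rewrite ler_wpM2l.
pose Q h := h^-1 *: (df (z + h) - df z).
have QC h k : h != 0 -> k != 0 -> cabs h < q -> cabs k < q ->
    rnorm (Q h - Q k) <= 4 / (3 * q) * (L2 * (cabs h + cabs k)).
  move=> h0 k0 hq kq.
  have quot s v : v != 0 -> cabs (s - z) < q -> cabs v < q ->
      rnorm (v^-1 *: (f (s + v) - f s) - df s) <= L2 * cabs v.
    move=> v0 sq vq; have v00 : 0 < cabs v by rewrite (rnorm_gt0 (v : R[i]^o)).
    rewrite -(ler_pM2l v00) -rnormZl scalerBr scalerA divff// scale1r.
    by rewrite -addrA -opprD mulrC; exact: quad.
  have der u v : v != 0 -> cabs (u - z) < q -> cabs v < q ->
      has_derivative (fun u => v^-1 *: (f (u + v) - f u)) u (v^-1 *: (df (u + v) - df u)).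
    move=> v0 uq vq; apply: has_derivativeZr.
    apply: has_derivativeB; last by apply: fd'; lra.
    rewrite (_ : (fun _ => _) = (fun u => f (v + u))); last first.
      by apply/funext => a; rewrite addrC.
    apply: has_derivative_shift; rewrite addrC; apply: fd'.
    by have := tri u v; lra.
  apply: (@cauchy_estimate _
    (fun u => h^-1 *: (f (u + h) - f u) - k^-1 *: (f (u + k) - f u)) z) => //.
  - by move=> u us; eexists; apply: has_derivativeB; apply: der.
  - move=> u us; rewrite -(subrK (df u) (h^-1 *: _)) -addrA.
    rewrite (le_trans (ler_rnormD _ _))// mulrDr lerD ?quot//.
    by rewrite rnormB quot.
  - by apply: has_derivativeB; apply: der => //; rewrite subrr rnorm0.
suff dfz : derivable (df : R[i]^o -> V) (z : R[i]^o) 1.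
  by exists (derive1 (df : R[i]^o -> V) z); exact: derivable_has_derivative.
apply: cauchy_cvg; apply/cauchyP => e /complex_gt0[-> e0].
set ee := complex.Re e in e0 *.
pose K := 4 / (3 * q) * (L2 * 2) + 1.
have K0 : 0 < K by rewrite ltr_wpDl// mulr_ge0// mulr_ge0.
pose h0 := Num.min (q / 2) (ee / (K * 2)).
have h00 : 0 < h0 by rewrite lt_min !divr_gt0//; lra.
have h0q : h0 < q by rewrite gt_min; apply/orP; left; lra.
have h0e : K * h0 < ee.
  rewrite (@le_lt_trans _ _ (K * (ee / (K * 2))))//.
    by rewrite ler_pM2l// ge_min lexx orbT.
  by rewrite (_ : K * _ = ee / 2); [lra|field; rewrite gt_eqF].
have nh0 : cabs h0%:C = h0 by rewrite cabsR ger0_norm// ltW.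
exists (Q h0%:C); apply/nbhs_ballP; exists h0%:C => /=; first by rewrite ltcR.
move=> h; rewrite -ball_normE /= sub0r normrN -rnormE ltcR => hh hn0.
rewrite -ball_normE /= -rnormE ltcR [h *: 1]mulr1 (addrC h) -/(Q h).
apply: le_lt_trans h0e.
apply: le_trans (QC _ _ _ _ _ _) _ => //.
- by rewrite -(rnorm_gt0 (h0%:C : R[i]^o)) nh0.
- by rewrite nh0.
- exact: lt_trans hh h0q.
rewrite nh0 /K mulrDl mul1r.
have : L2 * (h0 + cabs h) <= L2 * (h0 + h0) by rewrite ler_wpM2l// lerD2l ltW.
by move=> /(ler_wpM2l c0); lra.
Qed.

End derivative_of_derivative.

(** * Sectors *)

Section sectors.
Local Open Scope complex_scope.
Context {R : realType}.
Local Notation C := R[i].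
Local Notation cabs z := (@rnorm R R[i]^o z).
Implicit Types (z w h s l : C) (theta : R).

(** Comparing cosines avoids all discussion of the branch of the argument. *)
Lemma sectorE theta z : 0 < theta <= pi ->
  sector theta z <-> cos theta * cabs z < complex.Re z.
Proof.
move=> /andP[t0 tpi].
have [->|z0] := eqVneq z 0.
  by split=> [[]|]; rewrite ?eqxx//= (@rnorm0 R R[i]^o) mulr0 ltxx.
have [/andP[a1 a2] zE] := cargP z0.
have zp : 0 < cabs z by rewrite (rnorm_gt0 (z : R[i]^o)).
have -> : complex.Re z = cos (carg z) * cabs z.
  rewrite {1}zE -(rnormE (z : R[i]^o)) /=; simpc; rewrite /=; ring.
rewrite ltr_pM2r// -(cos_norm (carg z)) ltr_cos; last first.
- by rewrite in_itv /= (ltW t0).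
- by rewrite in_itv /= normr_ge0 ler_norml a2 ltW.
by split=> [[]|].
Qed.

Lemma sector_open theta z : 0 < theta <= pi -> sector theta z ->
  exists2 r : R, 0 < r & forall w, cabs (w - z) < r -> sector theta w.
Proof.
move=> t /(sectorE z t) zt; exists ((complex.Re z - cos theta * cabs z) / 2).
  by rewrite divr_gt0// subr_gt0.
move=> w wz; apply/(sectorE w t).
have := ler_Re_cabs (w - z); rewrite raddfB /= ler_norml.
have := cos_max theta; rewrite ler_norml => /andP[c1 c2].
have := ler_rnormD (w - z : R[i]^o) z; rewrite subrK.
have := ler_rnormD (z - w : R[i]^o) w; rewrite subrK (rnormB (z : R[i]^o) w).
have := rnorm_ge0 (w - z : R[i]^o).
move: wz; set n := cabs (w - z); set c := cos theta in c1 c2 *.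
by move=> wz n0 h1 h2 /andP[h3 h4]; nra.
Qed.

Lemma sector_rotate theta theta1 l s : 0 < theta1 -> theta <= pi ->
    sector theta1 l -> `|complex.Im s| < theta - theta1 ->
  sector theta (l * cexp s).
Proof.
move=> t0 tpi [l0 lt] st.
have t1 : 0 < theta <= pi.
  by rewrite tpi andbT; have := normr_ge0 (complex.Im s); lra.
have [_ lE] := cargP l0.
have lp : 0 < cabs l by rewrite (rnorm_gt0 (l : R[i]^o)).
apply/sectorE => //.
set a := carg l in lt lE; set y := complex.Im s in st.
have ay : `|a + y| < theta by have := ler_normD a y; lra.
have ReE : complex.Re (l * cexp s) = cos (a + y) * (cabs l * expR (complex.Re s)).
  rewrite {1}lE -(rnormE (l : R[i]^o)) /cexp -/y cosD /=; simpc; rewrite /=.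
  by ring.
rewrite cabsM cabs_cexp ReE ltr_pM2r ?mulr_gt0 ?expR_gt0//.
by rewrite -(cos_norm (a + y)) ltr_cos// in_itv /= ?normr_ge0; lra.
Qed.

Lemma sectorS theta theta1 l : theta1 <= theta -> sector theta1 l -> sector theta l.
Proof. by move=> t [l0 lt]; split=> //; exact: lt_le_trans t. Qed.

End sectors.

(** * The operator z d/dz and its powers *)

Section scaled_derivatives.
Local Open Scope complex_scope.
Context {R : realType}.
Local Notation C := R[i].
Local Notation cabs z := (@rnorm R R[i]^o z).
Implicit Types (z w h s l : C) (theta : R).

Lemma holomorphic_derive1 (V : completeNormedModType R[i]) (T : R[i]^o -> V) theta :
    0 < theta <= pi -> holomorphic_on (sector theta) T ->
  holomorphic_on (sector theta) (derive1 T).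
Proof.
move=> t Th z zt; have [r r0 zr] := sector_open t zt.
have [|E dE] := @derivative_differentiable R V T (derive1 T) z r r0.
  by move=> s /zr sz; exact/derivable_has_derivative/Th.
by have [] := has_derivative_derivable dE.
Qed.

Lemma holomorphic_derive1n (V : completeNormedModType R[i]) (T : R[i]^o -> V) theta k :
    0 < theta <= pi -> holomorphic_on (sector theta) T ->
  holomorphic_on (sector theta) (derive1n k T).
Proof.
move=> t Th; elim: k => [//|k IH].
by rewrite derive1nS; exact: holomorphic_derive1.
Qed.

(** In the logarithmic coordinate, [z d/dz] at [l] is the derivative at 0 of
    [s |-> f (l * cexp s)], and this function is holomorphic with values in [D] on the
    strip [|Im s| < theta - theta1], in particular on the disc of this radius. *)
Lemma euler_derivative_abs_convex (V : normedModType R[i]) (f : C -> V) (D : set V)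
    theta theta1 l E :
    0 < theta1 < theta -> theta <= pi ->
    (forall z, sector theta z -> exists E', has_derivative f z E') ->
    (forall z, sector theta z -> D (f z)) -> abs_convex D -> limit_closed D ->
    sector theta1 l -> has_derivative f l E ->
  D ((3 / 4 * (theta - theta1))%:C *: (l *: E)).
Proof.
move=> /andP[t0 t1] tpi fd fD Dc Dl lt fE.
have in_sector s : cabs s < theta - theta1 -> sector theta (l * cexp s).
  move=> st; apply: (@sector_rotate _ _ theta1) => //.
  exact: le_lt_trans (ler_Im_cabs s) st.
have der s E' : has_derivative f (l * cexp s) E' ->
    has_derivative (fun s => f (l * cexp s)) s ((l * cexp s) *: E').
  move=> fE'.
  have h := has_derivativeZr l (has_derivative_cexp s).
  exact: has_derivative_comp h fE'.
apply: (@derivative_abs_convex _ _ (fun s => f (l * cexp s))) => //.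
- lra.
- by move=> s /in_sector /fd[E' /der sE]; eexists; exact: sE.
- by move=> s /in_sector /fD.
- by have := der 0 E; rewrite cexp0 mulr1; exact.
Qed.

Lemma has_derivative_exp k z :
  has_derivative (fun s => s ^+ k : R[i]^o) z (k%:R * z ^+ k.-1).
Proof.
elim: k => [|k IH]; first by rewrite mul0r; exact: has_derivative_cst.
have := has_derivativeZ (has_derivative_id z) IH.
rewrite (_ : _ + _ = k.+1%:R * z ^+ k.+1.-1 :> C).
  by rewrite (_ : (fun s : C => _) = (fun s => s ^+ k.+1 : R[i]^o))//;
    apply/funext => s; rewrite exprS.
rewrite [1 *: _]mul1r [z *: _]mulrCA /= -[k.+1]addn1 natrD.
by case: k {IH} => [|k] /=; rewrite ?expr0 ?exprS; ring.
Qed.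

(** With [U_k z = z^k *: T^(k) z] one has [z U_k' = k *: U_k + U_(k+1)], so [U_(k+1)] is
    a combination of [z U_k'] and [U_k] with coefficients of total mass
    [4 / (3 (theta - theta1)) + k]. *)
Lemma euler_step (V : completeNormedModType R[i]) (T : R[i]^o -> V) (D : set V)
    theta0 theta theta1 l k :
    0 < theta1 < theta -> theta <= theta0 <= pi ->
    holomorphic_on (sector theta0) T ->
    (forall z, sector theta z -> D (z ^+ k *: derive1n k T z)) ->
    abs_convex D -> limit_closed D -> sector theta1 l ->
  D (((4 / (3 * (theta - theta1)) + k%:R)^-1)%:C *: (l ^+ k.+1 *: derive1n k.+1 T l)).
Proof.
move=> /andP[t0 t1] /andP[tt0 t0pi] Th TD Dc Dl lt.
have t0p : 0 < theta0 <= pi by rewrite t0pi andbT; lra.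
have der z : sector theta z -> has_derivative (fun z => z ^+ k *: derive1n k T z) z
    ((k%:R * z ^+ k.-1 : R[i]^o) *: derive1n k T z + z ^+ k *: derive1n k.+1 T z).
  move=> zt; apply: has_derivativeZ; first exact: has_derivative_exp.
  rewrite derive1nS; apply: derivable_has_derivative.
  exact: (@holomorphic_derive1n V T theta0 k t0p Th z (sectorS tt0 zt)).
have lt' : sector theta l by apply: sectorS lt; exact: ltW.
have DU : D ((3 / 4 * (theta - theta1))%:C *: (l *:
    ((k%:R * l ^+ k.-1 : R[i]^o) *: derive1n k T l + l ^+ k *: derive1n k.+1 T l))).
  apply: euler_derivative_abs_convex TD Dc Dl lt (der l lt').
  - by rewrite t0.
  - exact: le_trans t0pi.
  - by move=> z /der; eexists; eassumption.
move: DU.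
set U := l ^+ k *: derive1n k T l; set U' := l ^+ k.+1 *: _.
have -> : l *: (((k%:R * l ^+ k.-1) : R[i]^o) *: derive1n k T l +
    l ^+ k *: derive1n k.+1 T l) =
    k%:R *: U + U'.
  rewrite scalerDr /U /U' !scalerA -exprS; congr (_ *: _ + _).
  by case: k {TD der U U'} => [|k]; rewrite ?mul0r ?mulr0// mulrCA -exprS.
move=> DU.
set d := theta - theta1 in DU *; have d0 : 0 < d by rewrite subr_gt0.
set c := 4 / (3 * d) + k%:R.
have k0 : 0 <= k%:R :> R := ler0n _ _.
have d4 : 0 < 4 / (3 * d) by rewrite divr_gt0//; lra.
have c0 : 0 < c by rewrite ltr_wpDr.
rewrite (_ : _ *: U' = (4 / (3 * d) / c)%:C *: ((3 / 4 * d)%:C *: (k%:R *: U + U')) +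
                        (- (k%:R / c))%:C *: U).
  apply: Dc => //; first exact: TD.
  have c1 : 0 <= k%:R / c by rewrite divr_ge0// ltW.
  have c2 : 0 <= 4 / (3 * d) / c by rewrite divr_ge0// ltW.
  by rewrite normrN !ger0_norm// -mulrDl divff// gt_eqF.
rewrite scalerA -rmorphM (_ : 4 / (3 * d) / c * (3 / 4 * d) = c^-1); last first.
  by rewrite [LHS]mulrAC (_ : 4 / (3 * d) * (3 / 4 * d) = 1) ?mul1r//; field; lra.
have -> : (- (k%:R / c))%:C *: U = - ((c^-1)%:C *: (k%:R *: U)).
  by rewrite rmorphN rmorphM rmorph_nat scaleNr scalerA mulrC.
by rewrite scalerDr addrAC subrr add0r.
Qed.

End scaled_derivatives.

(** * A numerical inequality *)

Section sine_bound.
Context {R : realType}.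
Implicit Types x a v : R.

Lemma sin_le_id x : 0 <= x -> sin x <= x.
Proof.
move=> x0.
have [|c _] := @MVT_segment R (@sin R) cos 0 x x0.
  exact/continuous_subspaceT/continuous_sin.
rewrite sin0 !subr0 => ->; rewrite ler_piMl// cos_le1//.
Qed.

Lemma le_of_sqr x a : 0 <= a -> x ^+ 2 <= a ^+ 2 -> x <= a.
Proof.
move=> a0 xa; rewrite (le_trans (ler_norm x))//.
by rewrite -(@ler_sqr R) ?nnegrE// real_normK ?num_real.
Qed.

Lemma cos_pi6_sqr : cos (pi / 6 : R) ^+ 2 = 3 / 4.
Proof.
have pi0 := pi_gt0 R.
have c0 : 0 < cos (pi / 6 : R).
  by apply: cos_gt0_pihalf; lra.
have : cos (pi / 6 *+ 2 + pi / 6 : R) = 0.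
  by rewrite (_ : _ + _ = pi / 2) ?cos_pihalf//; field.
rewrite cosD cos_mulr2n sin_mulr2n.
have := cos2Dsin2 (pi / 6 : R).
set c := cos _ in c0 *; set s := sin _ => cs E.
have s2 : s ^+ 2 = 1 - c ^+ 2 by lra.
have : c * (4 * c ^+ 2 - 3) = 0.
  transitivity (c * (2 * c ^+ 2 - 1 - 2 * s ^+ 2)); first by rewrite s2; ring.
  by rewrite -[RHS]E; ring.
by move/eqP; rewrite mulf_eq0 gt_eqF//= => /eqP; lra.
Qed.

(** From [sin (pi/12) <= pi/12] and the value of [cos (pi/6)]. *)
Lemma pi_gt37_12 : 37 / 12 < pi :> R.
Proof.
have pi0 := pi_gt0 R.
have h : sin (pi / 12 : R) <= pi / 12 by apply: sin_le_id; lra.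
have h0 : 0 <= sin (pi / 12 : R) by apply: sin_ge0_pi; lra.
have cE : cos (pi / 6 : R) = 1 - 2 * sin (pi / 12) ^+ 2.
  rewrite (_ : pi / 6 = pi / 12 *+ 2); last by field.
  by rewrite cos_mulr2n; have := cos2Dsin2 (pi / 12 : R); lra.
have := cos_pi6_sqr; rewrite cE.
move: (sin (pi / 12)) h h0 => s h h0 E.
have s1 : 1 - 2 * s ^+ 2 <= 13 / 15.
  by apply: le_of_sqr; [|rewrite E]; lra.
rewrite ltNge; apply/negP => pi3.
have s2 : s <= 37 / 144 by lra.
have : s ^+ 2 <= (37 / 144) ^+ 2 by rewrite ler_sqr ?nnegrE//; lra.
lra.
Qed.

(** Compares the constant [4 / (3 x)] obtained from the Cauchy formula with the
    claimed [1 / sin^2 x].  The maximum of [sin^2 x / x] is about 0.725, so there is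
    little room; for [2 x >= pi/2] the tangents of [-cos] at [pi/2], [2 pi/3] and
    [3 pi/4] suffice on successive intervals. *)
Lemma sin_sqr_le x : 0 <= x -> 4 * sin x ^+ 2 <= 3 * x.
Proof.
move=> x0; have pi3 := pi_gt37_12.
have sinE : 4 * sin x ^+ 2 = 2 - 2 * cos (x *+ 2).
  by rewrite cos_mulr2n; have := cos2Dsin2 x; lra.
(* To the right of a, -cos lies below its tangent at a. *)
have tangent a : 0 <= sin a -> cos a <= 0 -> a <= x *+ 2 ->
    4 * sin x ^+ 2 <= 2 - 2 * cos a + 2 * (x *+ 2 - a) * sin a.
  move=> sa ca ax; rewrite sinE.
  have v0 : 0 <= x *+ 2 - a by lra.
  have : cos a - (x *+ 2 - a) * sin a <= cos (x *+ 2); last by lra.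
  have -> : cos (x *+ 2) = cos (a + (x *+ 2 - a)) by congr cos; ring.
  rewrite cosD; have := sin_le_id v0; have := cos_le1 (x *+ 2 - a).
  move: (cos (_ - _)) (sin (_ - _)) => C S C1 Sv.
  have : 0 <= - cos a * (1 - C) by rewrite mulr_ge0//; lra.
  have : 0 <= sin a * (x *+ 2 - a - S) by rewrite mulr_ge0//; lra.
  lra.
have [x1|x1] := leP x (3 / 4).
  have := sin_le_id x0; have : 0 <= sin x by apply: sin_ge0_pi; lra.
  move=> s0 s1; have : sin x ^+ 2 <= x ^+ 2 by rewrite ler_sqr ?nnegrE.
  have : x * x <= 3 / 4 * x by rewrite ler_wpM2r.
  by rewrite -expr2; lra.
have [x2|x2] := leP (x *+ 2) (pi / 2).
  have : 0 <= cos (x *+ 2) by apply: cos_ge0_pihalf; lra.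
  by rewrite sinE; lra.
have [x3|x3] := leP (x *+ 2) (2 / 3 * pi).
  have := tangent (pi / 2); rewrite sin_pihalf cos_pihalf => /(_ ler01 (lexx _) (ltW x2)).
  by lra.
have c6 := cos_pi6_sqr.
have c60 : 0 <= cos (pi / 6 : R) by apply: cos_ge0_pihalf; lra.
have s6 : sin (pi / 6 : R) <= 1 / 2.
  have := cos2Dsin2 (pi / 6 : R); rewrite c6 => E.
  by apply: le_of_sqr; lra.
have s60 : 0 <= sin (pi / 6 : R) by apply: sin_ge0_pi; lra.
have [x4|x4] := leP (x *+ 2) (3 / 4 * pi).
  have := tangent (pi / 6 + pi / 2); rewrite cosDpihalf sinDpihalf.
  have : cos (pi / 6 : R) <= 13 / 15.
    by apply: le_of_sqr; [|rewrite c6]; lra.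
  move: (cos _) (sin _) c60 s6 s60 {tangent c6} => C S C0 S1 S0 C1 h.
  have {h} := h C0; rewrite oppr_le0 => /(_ S0) h.
  have {}h : 4 * sin x ^+ 2 <= 2 - 2 * - S + 2 * (x *+ 2 - (pi / 6 + pi / 2)) * C.
    by apply: h; lra.
  have : (x *+ 2 - (pi / 6 + pi / 2)) * C <= (x *+ 2 - (pi / 6 + pi / 2)) * (13 / 15).
    by rewrite ler_wpM2l//; lra.
  lra.
have := tangent (pi / 4 + pi / 2); rewrite cosDpihalf sinDpihalf.
have c40 : 0 <= cos (pi / 4 : R) by apply: cos_ge0_pihalf; lra.
have s40 : 0 <= sin (pi / 4 : R) by apply: sin_ge0_pi; lra.
have c4 : cos (pi / 4 : R) ^+ 2 = 1 / 2.
  have := cos_pihalf R; rewrite (_ : pi / 2 = pi / 4 *+ 2); last by field.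
  by rewrite cos_mulr2n; lra.
have s4 : sin (pi / 4 : R) ^+ 2 = 1 / 2 by have := cos2Dsin2 (pi / 4 : R); lra.
move: (cos _) (sin _) c40 s40 c4 s4 {tangent c6 c60 s6 s60} => C S C0 S0 C2 S2 h.
have C1 : C <= 17 / 24 by apply: le_of_sqr; lra.
have S1 : S <= 17 / 24 by apply: le_of_sqr; lra.
have {h} := h C0; rewrite oppr_le0 => /(_ S0) h.
have {}h : 4 * sin x ^+ 2 <= 2 - 2 * - S + 2 * (x *+ 2 - (pi / 4 + pi / 2)) * C.
  by apply: h; lra.
have : (x *+ 2 - (pi / 4 + pi / 2)) * C <= (x *+ 2 - (pi / 4 + pi / 2)) * (17 / 24).
  by rewrite ler_wpM2l//; lra.
lra.
Qed.

End sine_bound.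

(** * Rademacher sums *)

Section rademacher_sums.
Local Open Scope complex_scope.
Context {R : realType} {N : nat}.
Implicit Types (X Y : normedModType R[i]) (p a b K : R) (sigma : {ffun 'I_N -> bool}).

Definition signed_sum X sigma (v : 'I_N -> X) : X :=
  \sum_nu ((-1) ^+ sigma nu : R)%:C *: v nu.

(** [2^N] times the p-th moment of the norm of a Rademacher sum. *)
Definition rademacher_sum X p (v : 'I_N -> X) : R :=
  \sum_(sigma : {ffun 'I_N -> bool}) rnorm (signed_sum sigma v) `^ p.

Lemma rademacher_sum_ge0 X p (v : 'I_N -> X) : 0 <= rademacher_sum p v.
Proof. by apply: sumr_ge0 => sigma _; exact: powR_ge0. Qed.

Lemma signed_sumZ X sigma (a : R[i]) (v : 'I_N -> X) :
  signed_sum sigma (fun i => a *: v i) = a *: signed_sum sigma v.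
Proof.
by rewrite scaler_sumr; apply: eq_bigr => i _; rewrite !scalerA mulrC.
Qed.

Lemma rademacher_sumZ X p a (v : 'I_N -> X) : 0 <= a ->
  rademacher_sum p (fun i => a%:C *: v i) = a `^ p * rademacher_sum p v.
Proof.
move=> a0; rewrite mulr_sumr; apply: eq_bigr => sigma _.
by rewrite signed_sumZ rnormZl cabsR ger0_norm// powRM// rnorm_ge0.
Qed.

Definition update X (v : 'I_N -> X) j x : 'I_N -> X := fun i => if i == j then x else v i.

Let flip j sigma : {ffun 'I_N -> bool} := [ffun i => (i == j) (+) sigma i].

Let flipK j : involutive (flip j).
Proof. by move=> sigma; apply/ffunP => i; rewrite !ffunE addKb. Qed.

(** Changing the sign of one vector permutes the sign patterns. *)
Lemma rademacher_sum_updateN X p (v : 'I_N -> X) j x :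
  rademacher_sum p (update v j (- x)) = rademacher_sum p (update v j x).
Proof.
rewrite [RHS](reindex_inj (inv_inj (flipK j))); apply: eq_bigr => sigma _.
congr (rnorm _ `^ p); apply: eq_bigr => i _; rewrite ffunE /update.
by case: eqP => //= _; rewrite signrN rmorphN scalerN scaleNr.
Qed.

Lemma signed_sum_update X sigma (v : 'I_N -> X) j x y a b : a + b = 1 ->
  signed_sum sigma (update v j (a%:C *: x + b%:C *: y)) =
  a%:C *: signed_sum sigma (update v j x) + b%:C *: signed_sum sigma (update v j y).
Proof.
move=> ab; rewrite -!signed_sumZ -big_split; apply: eq_bigr => i _ /=.
rewrite -scalerDr /update; case: eqP => // _.
by rewrite -scalerDl -rmorphD /= ab scale1r.
Qed.

Lemma powR_convex p x y a b : 1 <= p -> 0 <= x -> 0 <= y -> 0 <= a -> 0 <= b ->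
  a + b = 1 -> (a * x + b * y) `^ p <= a * x `^ p + b * y `^ p.
Proof.
move=> p1 x0 y0 a0 b0 ab; have a1 : a <= 1 by lra.
have -> : b = 1 - a by lra.
by apply: (convex_powR p1 (Itv01 a0 a1)); rewrite ?inE/= ?in_itv/= ?andbT.
Qed.

Lemma rademacher_sum_convex X p (v : 'I_N -> X) j x y a b : 1 <= p ->
    0 <= a -> 0 <= b -> a + b = 1 ->
  rademacher_sum p (update v j (a%:C *: x + b%:C *: y)) <=
  a * rademacher_sum p (update v j x) + b * rademacher_sum p (update v j y).
Proof.
move=> p1 a0 b0 ab; rewrite !mulr_sumr -big_split; apply: ler_sum => sigma _ /=.
apply: le_trans (powR_convex p1 (rnorm_ge0 _) (rnorm_ge0 _) a0 b0 ab).
apply: ge0_ler_powR; rewrite ?nnegrE ?rnorm_ge0 ?addr_ge0 ?mulr_ge0 ?rnorm_ge0//.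
  by lra.
rewrite signed_sum_update// (le_trans (ler_rnormD _ _))// !rnormZl !cabsR.
by rewrite !ger0_norm.
Qed.

Lemma rnorm_signed_sum_update X sigma (v : 'I_N -> X) j x y :
  rnorm (signed_sum sigma (update v j y)) <=
  rnorm (signed_sum sigma (update v j x)) + rnorm (y - x).
Proof.
rewrite -(subrK (signed_sum sigma (update v j x)) (signed_sum _ (update v j y))).
rewrite addrC (le_trans (ler_rnormD _ _))// lerD2l.
rewrite -sumrB (bigD1 j)//= big1 ?addr0 => [|i ij].
  rewrite -scalerBr rnormZl cabsR normrX normrN1 expr1n mul1r /update eqxx.
  by [].
by rewrite /update (negPf ij) subrr.
Qed.

Let continuity_bound X p (v : 'I_N -> X) j y : 1 <= p -> exists B, forall x,
  rnorm (x - y) <= 2 -> rademacher_sum p (update v j x) <= B.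
Proof.
move=> p1; exists (\sum_(sigma : {ffun 'I_N -> bool})
  (rnorm (signed_sum sigma (update v j y)) + 2) `^ p) => x xy.
apply: ler_sum => sigma _; apply: ge0_ler_powR; rewrite ?nnegrE ?rnorm_ge0//.
- by lra.
- by rewrite addr_ge0// rnorm_ge0.
- by rewrite (le_trans (rnorm_signed_sum_update _ _ _ y _))// lerD2l.
Qed.

(** Continuity follows from convexity: [y] lies between a nearby [x] and a point [z]
    at bounded distance, with weight close to 1 on [x]. *)
Lemma rademacher_sum_limit X p K (v : 'I_N -> X) j y : 1 <= p ->
    (forall e, 0 < e -> exists2 x, rademacher_sum p (update v j x) <= K &
      rnorm (y - x) <= e) ->
  rademacher_sum p (update v j y) <= K.
Proof.
move=> p1 yK; have [B yB] := continuity_bound v j y p1.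
have K0 : 0 <= K.
  by have [x + _] := yK 1 ltr01; apply: le_trans; exact: rademacher_sum_ge0.
have B0 : 0 <= B.
  by have := yB y; rewrite subrr rnorm0 => /(_ (ler0n _ _)); apply: le_trans;
    exact: rademacher_sum_ge0.
apply/ler_addgt0Pr => e e0.
pose t := Num.min 1 (e / (B + 1)).
have t0 : 0 < t by rewrite lt_min ltr01 divr_gt0//; lra.
have t1 : t <= 1 by rewrite ge_min lexx.
have tB : t * B <= e.
  rewrite (@le_trans _ _ (e / (B + 1) * B))//.
    by rewrite ler_wpM2r// ge_min lexx orbT.
  by rewrite mulrAC ler_pdivrMr; nra.
have [x xK xy] := yK t t0.
pose z := x + (t^-1)%:C *: (y - x).
have -> : y = (1 - t)%:C *: x + t%:C *: z.
  rewrite /z scalerDr scalerA -rmorphM divff ?gt_eqF// scale1r addrA -scalerDl.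
  by rewrite -rmorphD subrK scale1r addrC subrK.
apply: le_trans (rademacher_sum_convex _ _ _ _ p1 _ (ltW t0) _) _; [lra|lra|].
have zB : rademacher_sum p (update v j z) <= B.
  apply: yB; rewrite /z addrAC (le_trans (ler_rnormD _ _))// rnormZl cabsR.
  rewrite ger0_norm; last by rewrite invr_ge0 ltW.
  rewrite (rnormB x) -[2]/(1 + 1) lerD//; first exact: le_trans t1.
  by rewrite mulrC ler_pdivrMr// mul1r.
have : (1 - t) * rademacher_sum p (update v j x) <= 1 * K.
  by apply: ler_pM => //; [lra|exact: rademacher_sum_ge0|lra].
have : t * rademacher_sum p (update v j z) <= t * B by rewrite ler_wpM2l// ltW.
lra.
Qed.

Lemma symmetric_abs_convex X (D : set X) :
    (forall x, D x -> D (- x)) ->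
    (forall x y a b, D x -> D y -> 0 <= a -> 0 <= b -> a + b = 1 ->
      D (a%:C *: x + b%:C *: y)) ->
  abs_convex D.
Proof.
move=> DN Dc; have Ds x a : D x -> exists2 x', D x' & a%:C *: x = `|a|%:C *: x'.
  move=> Dx; have [a0|a0] := leP 0 a; first by exists x => //; rewrite ger0_norm.
  exists (- x); first exact: DN.
  by rewrite ltr0_norm// rmorphN scaleNr scalerN opprK.
have shrink x r : D x -> 0 <= r <= 1 -> D (r%:C *: x).
  move=> Dx r01; have -> : r%:C *: x =
      ((1 + r) / 2)%:C *: x + ((1 - r) / 2)%:C *: (- x).
    by rewrite scalerN -scaleNr -scalerDl -rmorphN -rmorphD; congr (_%:C *: _); field.
  by apply: Dc => //; [exact: DN|lra|lra|field].
move=> x y a b Dx Dy ab.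
have [x' Dx' ->] := Ds x a Dx; have [y' Dy' ->] := Ds y b Dy.
have a0 := normr_ge0 a; have b0 := normr_ge0 b.
move: (`|a|) (`|b|) a0 b0 ab => s t s0 t0 st.
have [st0|st0] := eqVneq (s + t) 0.
  have -> : s = 0 by lra.
  have -> : t = 0 by lra.
  by rewrite scale0r add0r; apply: shrink => //; rewrite lexx ler01.
have stp : 0 < s + t by rewrite lt_neqAle eq_sym st0 addr_ge0.
have -> : s%:C *: x' + t%:C *: y' =
    (s + t)%:C *: ((s / (s + t))%:C *: x' + (t / (s + t))%:C *: y').
  by rewrite scalerDr !scalerA -!rmorphM /= ![(s + t) * _]mulrC !divfK.
apply: shrink; last by rewrite st ltW.
by apply: Dc; rewrite ?divr_ge0 ?(ltW stp)// -mulrDl divff.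
Qed.

(** This is what allows one operator to be moved to the hull while the others stay
    fixed. *)
Lemma rademacher_sublevel X Y p K (v : 'I_N -> Y) j (x : X) : 1 <= p ->
  let D := [set S : bop X Y | rademacher_sum p (update v j (S x)) <= K] in
  abs_convex D /\ limit_closed D.
Proof.
move=> p1 D; split.
  apply: symmetric_abs_convex => [S DS|S S' a b DS DS' a0 b0 ab].
    have SN : (- S : bop X Y) x = - S x by rewrite -scaleN1r bopZE scaleN1r.
    by move: DS; rewrite /D /mkset SN rademacher_sum_updateN.
  rewrite /D /mkset bopDE !bopZE.
  apply: le_trans (rademacher_sum_convex _ _ _ _ p1 a0 b0 ab) _.
  by rewrite -[leRHS]mul1r -ab mulrDl lerD// ler_wpM2l.
move=> S DS; apply: rademacher_sum_limit => // e e0.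
have x0 := rnorm_ge0 x.
have [|S' DS' SS'] := DS (e / (rnorm x + 1)); first by rewrite divr_gt0//; lra.
exists (S' x) => //.
have -> : S x - S' x = (S - S') x.
  by rewrite -[S - S']/(S + - S') -[- S']scaleN1r bopDE bopZE scaleN1r.
rewrite (le_trans (rnorm_bop _ _))// -bop_normE.
rewrite (@le_trans _ _ (e / (rnorm x + 1) * rnorm x))//.
  by rewrite ler_wpM2r.
by rewrite mulrAC ler_pdivrMr; nra.
Qed.

(** The operators are moved from [F] to its closed absolutely convex hull one index
    at a time, so the bound [K] does not deteriorate. *)
Lemma rademacher_sum_hull X Y p K (F : set (bop X Y)) (x : 'I_N -> X) : 1 <= p ->
    (forall T : 'I_N -> bop X Y, (forall nu, F (T nu)) ->
      rademacher_sum p (fun nu => T nu (x nu)) <= K) ->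
  forall T : 'I_N -> bop X Y,
    (forall nu (D : set (bop X Y)), abs_convex D -> limit_closed D -> F `<=` D ->
      D (T nu)) ->
    rademacher_sum p (fun nu => T nu (x nu)) <= K.
Proof.
move=> p1 FK.
pose hull (S : bop X Y) := forall D : set (bop X Y),
  abs_convex D -> limit_closed D -> F `<=` D -> D S.
suff step m : forall T : 'I_N -> bop X Y,
    (forall nu : 'I_N, (nu < m)%N -> hull (T nu)) ->
    (forall nu : 'I_N, (m <= nu)%N -> F (T nu)) ->
    rademacher_sum p (fun nu => T nu (x nu)) <= K.
  move=> T Th; apply: (step N) => [nu _|nu]; first exact: Th.
  by rewrite leqNgt ltn_ord.
elim: m => [|m IH] T Th TF; first by apply: FK => nu; exact: TF.
have [mN|Nm] := ltnP m N; last first.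
  apply: IH => nu h; first exact: (Th _ (leqW h)).
  by have := ltn_ord nu; rewrite ltnNge (leq_trans Nm h).
pose j := Ordinal mN.
pose replace (S : bop X Y) nu : bop X Y := if nu == j then S else T nu.
have updE (S : bop X Y) : update (fun nu => T nu (x nu)) j (S (x j)) =
    (fun nu => replace S nu (x nu)).
  by apply/funext => nu; rewrite /update /replace; case: eqP => // ->.
have [Dc Dl] := rademacher_sublevel K (fun nu => T nu (x nu)) j (x j) p1.
have updT : update (fun nu => T nu (x nu)) j (T j (x j)) = (fun nu => T nu (x nu)).
  by apply/funext => nu; rewrite /update; case: eqP => // ->.
rewrite -updT; apply: (Th j (ltnSn m) _ Dc Dl).
move=> S FS /=; rewrite updE.
apply: (IH (replace S)) => nu h; rewrite /replace.
  rewrite (_ : (nu == j) = false); first exact: (Th _ (leqW h)).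
  by apply/negP => /eqP nj; move: h; rewrite nj ltnn.
by case: eqP => // /eqP nj; apply: TF; rewrite ltn_neqAle h andbT eq_sym.
Qed.

End rademacher_sums.

(** * Moments of Rademacher sums *)

Section rademacher_expectation.
Local Open Scope complex_scope.
Local Open Scope ereal_scope.
Context {R : realType} {d : measure_display} {Omega : measurableType d}
        {P : probability Omega R} {N : nat} (eps : 'I_N -> {RV P >-> R}).
Context (eps_independent : mutually_independent eps).
Context (eps_rademacher : forall nu, rademacher (eps nu)).
Implicit Types (sigma : {ffun 'I_N -> bool}).

Definition sign_event sigma : set Omega :=
  \bigcap_(i in [set` [set: 'I_N]%SET]) (eps i @^-1` [set ((-1) ^+ sigma i)%R]).

Let event_measurable sigma : measurable (sign_event sigma).
Proof.
apply: fin_bigcap_measurable => [|i _]; first exact: finite_finset.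
by apply: measurable_funPTI; exact: measurable_set1.
Qed.

Let event_probability sigma : P (sign_event sigma) = (2^-1 ^+ N)%:E.
Proof.
rewrite /sign_event eps_independent => [|i]; last exact: measurable_set1.
rewrite (eq_bigr (fun=> (2^-1)%:E)) => [|i _].
  by rewrite prodEFin prodr_const cardsT card_ord.
by have [P1 PN1] := eps_rademacher i; case: (sigma i); rewrite ?expr0 ?expr1.
Qed.

Let eventP sigma w i : sign_event sigma w -> eps i w = ((-1) ^+ sigma i)%R.
Proof. by move=> /(_ i); rewrite /= inE; exact. Qed.

Let event_disjoint sigma tau w : sign_event sigma w -> sign_event tau w -> sigma = tau.
Proof.
move=> sw tw; apply/ffunP => i; have := eventP i tw; rewrite (eventP i sw).
case: (sigma i); case: (tau i) => //; rewrite expr0 expr1 => /eqP.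
  by rewrite eq_sym -addr_eq0 -mulr2n pnatr_eq0.
by rewrite -addr_eq0 -mulr2n pnatr_eq0.
Qed.

Let step (g : {ffun 'I_N -> bool} -> R) w : \bar R :=
  \sum_sigma (g sigma)%:E * (\1_(sign_event sigma) w)%:E.

Let stepE g sigma w : sign_event sigma w -> step g w = (g sigma)%:E.
Proof.
move=> sw; rewrite /step (bigD1 sigma)//= big1 ?adde0 => [|tau ts].
  by rewrite indicE mem_set// mule1.
rewrite indicE memNset ?mule0// => tw.
by move: ts; rewrite (event_disjoint tw sw) eqxx.
Qed.

Let step_ge0 g w : (forall sigma, 0 <= g sigma)%R -> 0 <= step g w.
Proof. by move=> g0; apply: sume_ge0 => sigma _; rewrite -EFinM lee_fin mulr_ge0. Qed.

Let step_measurable g : measurable_fun setT (step g).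
Proof.
apply: emeasurable_sum => sigma.
by apply: measurable_funeM; apply/measurable_EFinP; exact: measurable_indic.
Qed.

Let integral_step g : (forall sigma, 0 <= g sigma)%R ->
  \int[P]_w step g w = (2^-1 ^+ N * \sum_sigma g sigma)%:E.
Proof.
move=> g0; rewrite ge0_integral_sum//=.
- rewrite mulr_sumr -sumEFin; apply: eq_bigr => sigma _.
  rewrite ge0_integralZl//=.
  + by rewrite integral_indic// setIT [X in _ * X](event_probability sigma) -EFinM mulrC.
  + by apply/measurable_EFinP; exact: measurable_indic.
  + by rewrite lee_fin.
- move=> sigma; apply: measurable_funeM; apply/measurable_EFinP.
  exact: measurable_indic.
- by move=> sigma w _; rewrite -EFinM lee_fin mulr_ge0.
Qed.

Let no_event : set Omega := [set w | forall sigma, ~ sign_event sigma w].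

Let no_event_negligible : measurable no_event /\ P no_event = 0.
Proof.
pose U := \bigcup_(sigma in [set: {ffun 'I_N -> bool}]) sign_event sigma.
have mU : measurable U by apply: fin_bigcup_measurable => // sigma _.
have -> : no_event = ~` U.
  by apply/seteqP; split=> [w nw [sigma _ /nw]//|w nw sigma sw]; apply: nw; exists sigma.
split; first exact: measurableC.
rewrite probability_setC// [P U](_ : _ = 1) ?subee//.
have : \int[P]_w step (fun=> 1%R) w = \int[P]_w (\1_U w)%:E.
  apply: eq_integral => w _; rewrite indicE.
  have [Uw|nUw] := pselect (U w).
    by have [sigma _ sw] := Uw; rewrite mem_set// (stepE _ sw).
  rewrite memNset// /step big1// => sigma _; rewrite indicE memNset ?mule0//.
  by move=> sw; apply: nUw; exists sigma.
rewrite integral_indic// setIT => <-; rewrite integral_step//.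
rewrite sumr_const card_ffun card_bool card_ord natrX -exprMn.
by rewrite mulVf ?expr1n// pnatr_eq0.
Qed.

(** Monotonicity without measurability: nothing is known about the integrand on the
    null set where some random sign is neither 1 nor -1. *)
Let le_integral (f g : Omega -> \bar R) :
  (forall w, 0 <= f w) -> (forall w, f w <= g w) -> \int[P]_w f w <= \int[P]_w g w.
Proof.
move=> f0 fg; rewrite !ge0_integralTE// => [|w]; last exact: le_trans (fg w).
by apply: ereal_sup_le => _ [h hf <-]; exists h => // w; exact: le_trans (fg w).
Qed.

(** Each sign pattern has probability [2^-N]; off the null set [no_event], [f] is a
    simple function, and it is squeezed between that function and the function
    that is infinite on [no_event]. *)
Lemma integral_rademacher (f : Omega -> \bar R) (g : {ffun 'I_N -> bool} -> R) :
    (forall w, 0 <= f w) -> (forall sigma, 0 <= g sigma)%R ->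
    (forall sigma w, (forall i, eps i w = (-1) ^+ sigma i)%R -> f w = (g sigma)%:E) ->
  \int[P]_w f w = (2^-1 ^+ N * \sum_sigma g sigma)%:E.
Proof.
move=> f0 g0 fg; have {}fg sigma w : sign_event sigma w -> f w = (g sigma)%:E.
  by move=> sw; apply: fg => i; exact: eventP.
rewrite -integral_step//; have [mE PE] := no_event_negligible.
have caseE w : no_event w \/ exists sigma, sign_event sigma w.
  have [|nw] := pselect (exists sigma, sign_event sigma w); [by right|left].
  by move=> sigma sw; apply: nw; exists sigma.
apply/eqP; rewrite eq_le; apply/andP; split; last first.
  apply: le_integral => w; first exact: step_ge0.
  have [nw|[sigma sw]] := caseE w; last by rewrite (fg _ _ sw) (stepE _ sw).
  rewrite /step big1// => sigma _; rewrite indicE memNset ?mule0//; exact: nw.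
have -> : \int[P]_w step g w = \int[P]_w (step g w + ((cst +oo) \_ no_event) w).
  rewrite ge0_integralD//=.
  - by rewrite -integral_mkcond integral_cst// [X in _ * X]PE mule0 adde0.
  - by move=> w _; exact: step_ge0.
  - by move=> w _; rewrite patchE; case: ifP => _ //=; rewrite leey.
  - apply/measurable_restrict => //; rewrite setTI; exact: measurable_cst.
apply: le_integral => // w; rewrite patchE.
have [nw|[sigma sw]] := caseE w.
  by rewrite mem_set// addey ?leey// gt_eqF// (lt_le_trans _ (step_ge0 _ _)).
by rewrite (fg _ _ sw) (stepE _ sw) leeDl//; case: ifP => _ //=; rewrite leey.
Qed.

Lemma Lnorm_rademacher (X : normedModType R[i]) (p : R) (v : 'I_N -> X) :
  'N[P]_p%:E[(fun w => (rnorm (\sum_nu (eps nu w)%:C *: v nu)%R)%:E)] =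
  ((2^-1 ^+ N * rademacher_sum p v) `^ p^-1)%:E.
Proof.
rewrite unlock /Lnorm -poweR_EFin; congr (_ `^ _).
apply: integral_rademacher => [w|sigma|sigma w sw].
- exact: poweR_ge0.
- exact: powR_ge0.
- rewrite gee0_abs ?lee_fin ?rnorm_ge0// poweR_EFin; congr (rnorm _ `^ _)%:E.
  by apply: eq_bigr => i _; rewrite sw.
Qed.

End rademacher_expectation.

(** * R-bounds of closed absolutely convex hulls *)

Section R_bounded_hull.
Local Open Scope complex_scope.
Context {R : realType} {X Y : normedModType R[i]}.
Implicit Types (p C c K : R) (F : set (bop X Y)).

Let powR_le_root p C q a b : 1 <= p -> 0 <= C -> 0 <= q -> 0 <= a -> 0 <= b ->
  a <= C `^ p * b -> (q * a) `^ p^-1 <= C * (q * b) `^ p^-1.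
Proof.
move=> p1 C0 q0 a0 b0 ab; have p0 : p != 0 by lra.
rewrite (@le_trans _ _ ((C `^ p * (q * b)) `^ p^-1))//.
  apply: ge0_ler_powR; rewrite ?nnegrE ?mulr_ge0 ?powR_ge0 ?invr_ge0//; first by lra.
  by rewrite mulrCA ler_wpM2l.
by rewrite powRM ?powR_ge0 ?mulr_ge0// -powRrM mulfV// powRr1.
Qed.

Let root_le_powR p C q a b : 1 <= p -> 0 <= C -> 0 < q -> 0 <= a -> 0 <= b ->
  (q * a) `^ p^-1 <= C * (q * b) `^ p^-1 -> a <= C `^ p * b.
Proof.
move=> p1 C0 q0 a0 b0 ab; have p0 : p != 0 by lra.
have root x : 0 <= x -> (x `^ p^-1) `^ p = x.
  by move=> x0; rewrite -powRrM mulVf// powRr1.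
have qa0 : 0 <= q * a by rewrite mulr_ge0// ltW.
have qb0 : 0 <= q * b by rewrite mulr_ge0// ltW.
rewrite -(ler_pM2l q0) mulrCA -(root _ qa0) -(root _ qb0) -powRM ?powR_ge0//.
by apply: ge0_ler_powR; rewrite ?nnegrE ?mulr_ge0 ?powR_ge0//; lra.
Qed.

(** For a fixed choice of signs, vectors and number of terms the R-bound is an
    inequality between finite averages, to which [rademacher_sum_hull] applies.
    Membership in the closed absolutely convex hull of [F] is expressed by testing
    against the closed absolutely convex sets that contain [F]. *)
Theorem R_bounded_by_hull p C c F F' : 1 <= p -> 0 < C -> 0 < c ->
    R_bounded_by p C F ->
    (forall S, F' S -> forall D : set (bop X Y), abs_convex D -> limit_closed D ->
      F `<=` D -> D ((c^-1)%:C *: S)) ->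
  R_bounded_by p (c * C) F'.
Proof.
move=> p1 C0 c0 FC F'F d Omega P N eps ind rad T x TF'.
have q0 : 0 < 2^-1 ^+ N :> R by rewrite exprn_gt0// invr_gt0.
rewrite !(Lnorm_rademacher ind rad) -EFinM lee_fin.
apply: powR_le_root; rewrite ?rademacher_sum_ge0 ?mulr_ge0 ?(ltW q0) ?(ltW C0) ?(ltW c0)//.
have FK (U : 'I_N -> bop X Y) : (forall nu, F (U nu)) ->
    rademacher_sum p (fun nu => U nu (x nu)) <= C `^ p * rademacher_sum p x.
  move=> UF; have := FC _ _ _ _ _ ind rad U x UF.
  rewrite !(Lnorm_rademacher ind rad) -EFinM lee_fin.
  by apply: (root_le_powR p1 (ltW C0) q0); exact: rademacher_sum_ge0.
have := rademacher_sum_hull p1 FK (T := fun nu => (c^-1)%:C *: T nu)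
  (fun nu D Dc Dl FD => F'F _ (TF' nu) D Dc Dl FD).
rewrite rademacher_sumZ; last by rewrite invr_ge0 ltW.
have [C0' c0' V0] : [/\ 0 <= C, 0 <= c & 0 <= c^-1] by rewrite invr_ge0 !ltW.
rewrite powRM// -mulrA => /(ler_wpM2l (powR_ge0 c p)); apply: le_trans.
by rewrite mulrA -powRM// mulfV ?gt_eqF// powR1 mul1r.
Qed.

Lemma R_bounded_byW p C C' F : C <= C' -> R_bounded_by p C F -> R_bounded_by p C' F.
Proof.
move=> CC' FC d Omega P N eps ind rad T x TF.
apply: le_trans (FC _ _ _ _ _ ind rad T x TF) _.
by rewrite lee_wpmul2r ?Lnorm_ge0// lee_fin.
Qed.

Lemma R_bounded_byS p C F F' : F' `<=` F -> R_bounded_by p C F -> R_bounded_by p C F'.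
Proof.
move=> F'F FC d Omega P N eps ind rad T x TF.
by apply: FC => // nu; exact: F'F.
Qed.

Lemma R_bounded_by_R_bound p C F : R_bound p F = C%:E ->
  forall C', C < C' -> 0 < C' /\ R_bounded_by p C' F.
Proof.
move=> FC C' CC'; have : (R_bound p F < C'%:E)%E by rewrite FC lte_fin.
move=> /ereal_inf_lt[_ [K [K0 KF] <-]]; rewrite lte_fin => KC'; split.
  exact: lt_trans KC'.
by apply: R_bounded_byW KF; exact: ltW.
Qed.

Lemma R_bound_le p C F : 0 < C -> R_bounded_by p C F -> (R_bound p F <= C%:E)%E.
Proof. by move=> C0 FC; apply: ereal_inf_lbound; exists C. Qed.

End R_bounded_hull.


(** * R-boundedness of the scaled derivatives *)

Theorem proposition2p7 (R : realType) (X : completeNormedModType R[i])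
    (p phi : R) (hp : 1 <= p) (hphi : 0 < phi < pi)
    (T : R[i]^o -> bop X X)
    (T_continuous : {within closure (sector (pi - phi)), continuous T})
    (T_holomorphic : holomorphic_on (sector (pi - phi)) T)
    (C : R)
    (T_R_bound : R_bound p [set T l | l in sector (pi - phi)] = C%:E) :
  (forall phi' : R, phi < phi' < pi ->
     (R_bound p [set l *: derive1 T l | l in sector (pi - phi')] <=
      (C / sin (phi' - phi) ^+ 2)%:E)%E) /\
  (forall (k : nat) (phi' : R), phi < phi' < pi ->
     (R_bound p [set l ^+ k *: derive1n k T l | l in sector (pi - phi')] <
      +oo)%E).
Proof.
have bounded := R_bounded_by_R_bound T_R_bound.
have sector_pi : pi - phi <= pi by lra.
split=> [phi' hphi'|k phi' hphi'].
  pose d := phi' - phi; have d0 : 0 < d by rewrite /d; lra.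
  have s0 : 0 < sin d by apply: sin_gt0_pi; rewrite /d; lra.
  have c0 : 0 < (3 / 4 * d)^-1 by rewrite invr_gt0; lra.
  have cs : (3 / 4 * d)^-1 <= (sin d ^+ 2)^-1.
    by rewrite lef_pV2 ?posrE ?exprn_gt0//; [have := sin_sqr_le (ltW d0)|]; lra.
  (* C is an infimum: work with C + e sin^2 d, which is an admissible constant. *)
  apply/lee_addgt0Pr => e e0.
  have [|C'0 C'F] := bounded (C + e * sin d ^+ 2).
    by rewrite ltrDl mulr_gt0// exprn_gt0.
  set C' := C + _ in C'0 C'F.
  rewrite (_ : _ + _ = ((sin d ^+ 2)^-1 * C')%:E)%E; last first.
    by rewrite -EFinD /C' mulrDr mulrCA mulVf ?mulr1 1?mulrC// gt_eqF// exprn_gt0.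
  apply: R_bound_le; first by rewrite mulr_gt0// invr_gt0 exprn_gt0.
  apply: (@R_bounded_byW _ _ _ _ ((3 / 4 * d)^-1 * C')); first by rewrite ler_pM2r.
  apply: R_bounded_by_hull C'F _ => // _ [l lphi' <-] D Dc Dl FD.
  rewrite invrK (_ : d = (pi - phi) - (pi - phi')); last by rewrite /d; ring.
  apply: (@euler_derivative_abs_convex _ _ T) => //.
  - by lra.
  - by move=> z /T_holomorphic /derivable_has_derivative Tz; eexists; exact: Tz.
  - by move=> z zphi; apply: FD; exists z.
  - apply: derivable_has_derivative; apply: T_holomorphic.
    by apply: sectorS lphi'; lra.
suff [C' [C'0 C'F]] : exists C', 0 < C' /\
    R_bounded_by p C' [set l ^+ k *: derive1n k T l | l in sector (pi - phi')].
  by apply: le_lt_trans (R_bound_le C'0 C'F) _; rewrite ltry.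
elim: k phi' hphi' => [|k IH] phi' hphi'.
  have [|C'0 C'F] := bounded (C + 1); first by rewrite ltrDl.
  exists (C + 1); split=> //; apply: R_bounded_byS C'F => _ [l lphi' <-].
  by exists l; rewrite ?expr0 ?scale1r//; apply: sectorS lphi'; lra.
(* An intermediate sector leaves room for one more derivative. *)
pose psi := (phi + phi') / 2.
have [|C' [C'0 C'F]] := IH psi; first by rewrite /psi; lra.
have k0 : 0 <= k%:R :> R := ler0n _ _.
have d0 : 0 < 4 / (3 * (pi - psi - (pi - phi'))).
  by rewrite divr_gt0//; rewrite /psi; lra.
have c0 : 0 < 4 / (3 * (pi - psi - (pi - phi'))) + k%:R by lra.
exists ((4 / (3 * (pi - psi - (pi - phi'))) + k%:R) * C'); split.
  by rewrite mulr_gt0.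
apply: R_bounded_by_hull C'F _ => // _ [l lphi' <-] D Dc Dl FD.
apply: (@euler_step _ _ T D (pi - phi)) => //; rewrite /psi; try lra.
by move=> z zpsi; apply: FD; exists z.
Qed.
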